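(* Let $m\in\mathbb{R}$ and $\omega\in(\pi/2,\pi)$. Let $(D,\mathcal{D}(D))$ be the Dirac operator with mass $m$ and infinite mass boundary conditions in $\Omega_\omega$, let $(D^\gamma,\mathcal{D}(D^\gamma))$, $|\gamma|=1$, be its self-adjoint extensions, and let $C$ be the charge conjugation operator $Cu=\sigma_1\overline{u}$ (see context). The only self-adjoint extensions of $(D,\mathcal{D}(D))$ such that $$C\mathcal{D}(D^\gamma)=\mathcal{D}(D^\gamma)$$ are the extensions $(D^\gamma,\mathcal{D}(D^\gamma))$ for $\gamma=\pm1$. In these cases, one has the anticommutation relation $$\{C,D^\gamma\}=CD^\gamma+D^\gamma C=0.$$
   Context: Pauli matrices: $\sigma_1=\begin{pmatrix}0&1\\ 1&0\end{pmatrix}$, $\sigma_2=\begin{pmatrix}0&-i\\ i&0\end{pmatrix}$, $\sigma_3=\begin{pmatrix}1&0\\ 0&-1\end{pmatrix}$; $\sigma\cdot a=\sigma_1a_1+\sigma_2a_2$ for $a\in\mathbb{R}^2$, $\sigma\cdot\nabla=\sigma_1\partial_1+\sigma_2\partial_2$. $\Omega_\omega=\{r(\cos\theta,\sin\theta): r>0,\ |\theta|<\omega\}$, with outer unit normal $\mathbf{n}$ (defined a.e. on $\partial\Omega_\omega$). For a unit vector $\mathbf{v}\in\mathbb{R}^2$, $\mathcal{B}_{\mathbf{v}}=-i\sigma_3(\sigma\cdot\mathbf{v})$. The operator $D$ on $L^2(\Omega_\omega,\mathbb{C}^2)$ is $$\mathcal{D}(D)=\{u\in H^1(\Omega_\omega;\mathbb{C}^2):\mathcal{B}_{\mathbf{n}}u=u\text{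 on }\partial\Omega_\omega\},\qquad Du=-i\sigma\cdot\nabla u+m\sigma_3u.$$ For $\omega\in(\pi/2,\pi)$, the self-adjoint extensions of $D$ are exactly the operators $D^\gamma$, $\gamma\in\mathbb{C}$, $|\gamma|=1$, given by $\mathcal{D}(D^\gamma)=\mathcal{D}(D)+\mathrm{span}(v_++\gamma v_-)$, $D^\gamma v=Dv$ for $v\in\mathcal{D}(D)$, $D^\gamma(v_++\gamma v_-)=i(v_+-\gamma v_-)+m\sigma_3(v_++\gamma v_-)$, where in polar coordinates $v_\pm=K_{\nu_0}(r)u_0(\theta)\mp iK_{\nu_0+1}(r)u_{-1}(\theta)$, $\nu_0=\frac{\pi-2\omega}{4\omega}$, $K_\nu$ is the modified Bessel function of the second kind, and $$u_0(\theta)=\frac{1}{2\sqrt{\omega}}\begin{pmatrix}e^{i\theta\nu_0}\\ -i e^{-i\theta\nu_0}\end{pmatrix},\qquad u_{-1}(\theta)=\frac{1}{2\sqrt{\omega}}\begin{pmatrix}e^{-i\theta(\nu_0+1)}\\ i e^{i\theta(\nu_0+1)}\end{pmatrix}.$$ The charge conjugation operator is the antiunitary map $Cu=\sigma_1\overline{u}$, acting pointwise on $\mathbb{C}^2$-valued functions. *)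

(* Defs.v *)
From HB Require Import structures.
From mathcomp Require Import all_boot all_order all_algebra.
From mathcomp Require Import all_classical all_reals all_analysis.
From mathcomp.real_closed Require Import complex.
Set Implicit Arguments.
Unset Strict Implicit.
Unset Printing Implicit Defensive.
Import Order.TTheory GRing.Theory Num.Theory.
Import numFieldNormedType.Exports.
Local Open Scope classical_set_scope.
Local Open Scope complex_scope.
Local Open Scope ring_scope.

Definition plane (R : realType) : Type := (R * R)%type.
Definition spinor (R : realType) : Type := 'cV[R[i]]_2.

(* Elements of L^2(Omega, C^2) are represented by functions on the whole plane,
   to be read modulo equality almost everywhere on Omega.  An unbounded
   operator is represented by its graph; graphs are meant to be closed under
   equality almost everywhere on Omega in both arguments. *)
Definition spinor_field (R : realType) : Type := plane R -> spinor R.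
Definition operator (R : realType) : Type :=
  set (spinor_field R * spinor_field R).

Section Spinors.
Variable R : realType.
Implicit Types (v : plane R) (z w : spinor R).

Definition imag : R[i] := 0 +i* 1.

Definition mx2 (a b c d : R[i]) : 'M[R[i]]_2 :=
  \matrix_(i, j) if i == 0 then (if j == 0 then a else b)
                 else (if j == 0 then c else d).

Definition sigma1 : 'M[R[i]]_2 := mx2 0 1 1 0.
Definition sigma2 : 'M[R[i]]_2 := mx2 0 (- imag) imag 0.
Definition sigma3 : 'M[R[i]]_2 := mx2 1 0 0 (- 1).

Definition sigma_dot v : 'M[R[i]]_2 :=
  v.1%:C *: sigma1 + v.2%:C *: sigma2.

Definition bmx v : 'M[R[i]]_2 := - imag *: (sigma3 *m sigma_dot v).

Definition spinor2 (a b : R[i]) : spinor R := \col_i if i == 0 then a else b.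

(* The four real coordinates of a C^2-valued function.  Measurability, (weak)
   differentiability and integration of such functions are understood
   coordinatewise. *)
Definition rcoord (T : Type) (im : bool) (i : 'I_2) (u : T -> spinor R) (x : T)
  : R := if im then complex.Im (u x i 0) else complex.Re (u x i 0).

Definition normsq z : R := \sum_i (complex.Re (z i 0) ^+ 2 + complex.Im (z i 0) ^+ 2).

Definition hdot z w : R[i] := \sum_i conjc (z i 0) * w i 0.

Definition cis (a : R) : R[i] := cos a +i* sin a.

End Spinors.

Section L2.
Context d (T : measurableType d) (R : realType).
Variables (mu : {measure set T -> \bar R}) (A : set T).

Definition L2 (u : T -> spinor R) : Prop :=
  (forall im i, measurable_fun A (rcoord im i u)) /\
  (\int[mu]_(x in A) (normsq (u x))%:E < +oo)%E.

Definition L2_cvg (u_ : nat -> T -> spinor R) (u : T -> spinor R) : Prop :=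
  (\int[mu]_(x in A) (normsq (u_ n x - u x))%:E)%E @[n --> \oo] --> 0%E.

Definition L2_dot (u v : T -> spinor R) : R[i] :=
  Rintegral mu A (fun x => complex.Re (hdot (u x) (v x))) +i*
  Rintegral mu A (fun x => complex.Im (hdot (u x) (v x))).

End L2.

Section Sobolev.
Variable R : realType.
Implicit Types (Om : set (R * R)) (v : plane R) (u g : spinor_field R).

Definition lebesgue2 :
  {measure set (measurableTypeR R * measurableTypeR R) -> \bar R} :=
  (@lebesgue_measure R \x @lebesgue_measure R)%E.

Definition e1 : R * R := (1, 0).
Definition e2 : R * R := (0, 1).

(* C^oo: all iterated directional derivatives exist and are differentiable. *)
Definition smooth (f : R * R -> R) : Prop :=
  forall (s : seq (R * R)) (x : R * R),
    differentiable (foldr (fun v h => 'D_v h) f s) x.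

Definition fun_supp (f : R * R -> R) : set (R * R) := closure [set x | f x != 0].

Definition test_fun Om (f : R * R -> R) : Prop :=
  [/\ smooth f, compact (fun_supp f) & fun_supp f `<=` Om].

(* [g] is the weak derivative of [u] in the direction [v] on [Om].  Real-valued
   test functions suffice, the relation being linear in the test function. *)
Definition weak_deriv Om v u g : Prop :=
  forall (f : R * R -> R) im i, test_fun Om f ->
    Rintegral lebesgue2 Om (fun x => rcoord im i u x * 'D_v f x) =
    - Rintegral lebesgue2 Om (fun x => rcoord im i g x * f x).

Definition H1_grad Om u g1 g2 : Prop :=
  [/\ L2 lebesgue2 Om u, L2 lebesgue2 Om g1, L2 lebesgue2 Om g2,
      weak_deriv Om e1 u g1 & weak_deriv Om e2 u g2].

Definition smooth_field u : Prop :=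
  forall im i, test_fun setT (rcoord im i u).

Definition deriv_field v u : spinor_field R := fun x =>
  \col_i ('D_v (rcoord false i u) x +i* 'D_v (rcoord true i u) x).

End Sobolev.

Section Wedge.
Variable R : realType.
Implicit Types (om m r nu : R) (x : R * R) (u : spinor_field R) (s : bool).

Definition wedge om : set (R * R) :=
  [set x | exists r theta, [/\ 0 < r, `|theta| < om &
                               x = (r * cos theta, r * sin theta)]].

(* The boundary of the wedge is made, up to the vertex, of the two half-lines
   theta = om ([s = true]) and theta = - om ([s = false]), parametrized by arc
   length r > 0. *)
Definition edge om s r : R * R :=
  if s then (r * cos om, r * sin om) else (r * cos om, - (r * sin om)).

Definition outer_normal om s : R * R :=
  if s then (- sin om, cos om) else (- sin om, - cos om).

Definition half_line : set R := `]0, +oo[.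

(* [t] is the trace on the boundary of the wedge of [u] in H^1: the restrictions
   to the boundary of some smooth compactly supported functions on the plane
   which converge to [u] in H^1(wedge) converge to [t] in L^2(boundary). *)
Definition is_trace om u (t : bool -> R -> spinor R) : Prop :=
  exists phi : nat -> spinor_field R, exists g1 g2 : spinor_field R,
  [/\ forall n, smooth_field (phi n),
      H1_grad (wedge om) u g1 g2,
      [/\ L2_cvg (@lebesgue2 R) (wedge om) phi u,
          L2_cvg (@lebesgue2 R) (wedge om)
            (fun n => deriv_field (e1 R) (phi n)) g1 &
          L2_cvg (@lebesgue2 R) (wedge om)
            (fun n => deriv_field (e2 R) (phi n)) g2] &
      forall s, L2 (@lebesgue_measure R) half_line (t s) /\
        L2_cvg (@lebesgue_measure R) half_line
          (fun n r => phi n (edge om s r)) (t s)].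

Definition boundary_cond om u : Prop :=
  exists2 t, is_trace om u t &
    forall s, ae_eq (@lebesgue_measure R) half_line
                (fun r => bmx (outer_normal om s) *m t s r) (t s).

Definition dirac_op om m : operator R :=
  [set p | L2 (@lebesgue2 R) (wedge om) p.2 /\
    exists g1 g2 : spinor_field R,
    [/\ H1_grad (wedge om) p.1 g1 g2,
        boundary_cond om p.1 &
        ae_eq (@lebesgue2 R) (wedge om) p.2
          (fun x => - imag R *: (sigma1 R *m g1 x + sigma2 R *m g2 x)
                    + m%:C *: (sigma3 R *m p.1 x))]].

Definition cosh r : R := (expR r + expR (- r)) / 2.

(* K_nu(x) = int_0^oo exp (- x cosh t) cosh (nu t) dt for x > 0. *)
Definition besselK nu r : R :=
  Rintegral (@lebesgue_measure R) `[0, +oo[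
    (fun t => expR (- r * cosh t) * cosh (nu * t)).

Definition radius x : R := Num.sqrt (x.1 ^+ 2 + x.2 ^+ 2).

(* Polar angle, in ]-pi, pi]. *)
Definition angle x : R :=
  if 0 <= x.2 then acos (x.1 / radius x) else - acos (x.1 / radius x).

Definition nu0 om : R := (pi - 2 * om) / (4 * om).

Definition u0 om (theta : R) : spinor R :=
  (1 / (2 * Num.sqrt om))%:C *:
  spinor2 (cis (theta * nu0 om)) (- imag R * cis (- (theta * nu0 om))).

Definition um1 om (theta : R) : spinor R :=
  (1 / (2 * Num.sqrt om))%:C *:
  spinor2 (cis (- (theta * (nu0 om + 1))))
          (imag R * cis (theta * (nu0 om + 1))).

Definition vplus om : spinor_field R := fun x =>
  (besselK (nu0 om) (radius x))%:C *: u0 om (angle x)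
  - (imag R * (besselK (nu0 om + 1) (radius x))%:C) *: um1 om (angle x).

Definition vminus om : spinor_field R := fun x =>
  (besselK (nu0 om) (radius x))%:C *: u0 om (angle x)
  + (imag R * (besselK (nu0 om + 1) (radius x))%:C) *: um1 om (angle x).

(* The operator D^gamma: an element of its domain is v + c (v_+ + gamma v_-)
   with v in the domain of the Dirac operator and c a complex number. *)
Definition dirac_ext om m (gamma : R[i]) : operator R :=
  [set p | [/\ L2 (@lebesgue2 R) (wedge om) p.1,
               L2 (@lebesgue2 R) (wedge om) p.2 &
    exists (v h : spinor_field R) (c : R[i]),
    [/\ dirac_op om m (v, h),
        ae_eq (@lebesgue2 R) (wedge om) p.1
          (fun x => v x + c *: (vplus om x + gamma *: vminus om x)) &
        ae_eq (@lebesgue2 R) (wedge om) p.2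
          (fun x => h x + c *:
             (imag R *: (vplus om x - gamma *: vminus om x)
              + m%:C *: (sigma3 R *m
                           (vplus om x + gamma *: vminus om x))))]]].

Definition op_domain (T : operator R) : set (spinor_field R) := fst @` T.

Definition op_adjoint om (T : operator R) : operator R :=
  [set p | [/\ L2 (@lebesgue2 R) (wedge om) p.1,
               L2 (@lebesgue2 R) (wedge om) p.2 &
    forall q, T q -> L2_dot (@lebesgue2 R) (wedge om) q.2 p.1 =
                     L2_dot (@lebesgue2 R) (wedge om) q.1 p.2]].

Definition densely_defined om (T : operator R) : Prop :=
  forall f, L2 (@lebesgue2 R) (wedge om) f ->
    exists2 u_ : nat -> spinor_field R, (forall n, op_domain T (u_ n)) &
      L2_cvg (@lebesgue2 R) (wedge om) u_ f.

Definition selfadjoint om (T : operator R) : Prop :=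
  densely_defined om T /\ T = op_adjoint om T.

Definition selfadjoint_extension om (T S : operator R) : Prop :=
  selfadjoint om S /\ T `<=` S.

Definition charge_conj u : spinor_field R := fun x =>
  sigma1 R *m map_mx (@conjc R) (u x).

Definition C_invariant (T : operator R) : Prop :=
  charge_conj @` op_domain T = op_domain T.

(* C T + T C = 0 on the domain of T, for a graph T single-valued up to equality
   almost everywhere; in particular C maps the domain of T into itself. *)
Definition C_anticommutes om (T : operator R) : Prop :=
  forall u f, T (u, f) ->
    exists2 g, T (charge_conj u, g) &
      ae_eq (@lebesgue2 R) (wedge om) (charge_conj f \+ g) (cst 0).

End Wedge.

(* Main.v *)
(* Pointwise, C v_+ = i v_+ and C v_- = i v_-, and C anticommutes with the Dirac
   operator; hence C maps the graph of D^gamma to that of -D^(conj gamma), and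
   everything reduces to: D^gamma and D^(conj gamma) have the same domain only if
   gamma is real.  This amounts to a v_+ + b v_- not being in the domain of D
   unless a = b = 0.  Such a combination is al K_nu0 u_0 + be K_(nu0+1) u_(-1), and
   it is not even in H^1 near the vertex.  On the part e <= x <= 2 e, |y| <= 4 e of
   the wedge, the increment of a smooth field between heights y and y + 3 e is
   bounded in mean square by a constant times its Dirichlet integral, uniformly in
   e, a bound that passes to limits in H^1; but the corresponding increments of
   K_nu(r) cos(nu theta) are at least of order e^(-|nu|), and nu = nu0, nu0 + 1 are
   both nonzero. *)
From HB Require Import structures.
Require Import Defs.
From mathcomp Require Import all_boot all_order all_algebra.
From mathcomp Require Import all_classical all_reals all_analysis.
From mathcomp.real_closed Require Import complex.
From mathcomp Require Import measurable_realfun ring lra.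
Set Implicit Arguments.
Unset Strict Implicit.
Unset Printing Implicit Defensive.
Import Defs Order.TTheory GRing.Theory Num.Theory.
Import numFieldNormedType.Exports.
Local Open Scope classical_set_scope.
Local Open Scope ring_scope.

(** * Charge conjugation of spinors *)

(** The graph of D^gamma consists of square integrable fields, so v_+ and v_- must be shown square
    integrable before they can be placed in any domain; this is why K_nu is studied on the whole
    plane, from its integral formula and for orders of modulus less than 1. Near the vertex,
    increments replace gradients because they call for neither derivatives nor asymptotics of K_nu:
    K_nu decreases in r, cos(nu theta) decreases in |theta|, and both r and |theta| grow along a
    vertical segment of the half-plane x > 0 that moves away from the axis. Such segments lie in the
    wedge because its opening exceeds pi. Uniformity in e reflects the scale invariance of the
    Dirichlet integral in the plane: squared increments are integrated over an area of order e^2,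
    which cancels the factor e^2 in front of the Dirichlet integral. The smooth fields are those
    that [is_trace] provides, which converge in H^1. Increments above and below the axis are taken
    together so as to isolate the coefficient of each singular field. *)

Section Conj.
Variable R : realType.
Implicit Types (z w : spinor R) (c : R[i]).

Definition cconj z : spinor R := sigma1 R *m map_mx (@conjc R) z.

(** Case analysis that yields the ring constants 0 and 1 of ['I_2] instead of [Ordinal] terms, so
    that the entry lemmas below apply. *)
Lemma ord2P (P : 'I_2 -> Prop) : P 0 -> P 1 -> forall i, P i.
Proof.
move=> P0 P1 [[|[|//]] lti].
  by have -> : Ordinal lti = 0 by apply/val_inj.
by have -> : Ordinal lti = 1 by apply/val_inj.
Qed.

Lemma spinorP z w : z 0 0 = w 0 0 -> z 1 0 = w 1 0 -> z = w.
Proof.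
by move=> h0 h1; apply/matrixP => i j; rewrite (ord1 j); elim/ord2P: i.
Qed.

Lemma big_ord2 (V : nmodType) (F : 'I_2 -> V) : \sum_i F i = F 0 + F 1.
Proof.
rewrite big_ord_recl big_ord1; congr (_ + F _); exact/val_inj.
Qed.

Lemma mx2_mul0 (a b c d : R[i]) z : (mx2 a b c d *m z) 0 0 = a * z 0 0 + b * z 1 0.
Proof. by rewrite mxE big_ord2 !mxE. Qed.

Lemma mx2_mul1 (a b c d : R[i]) z : (mx2 a b c d *m z) 1 0 = c * z 0 0 + d * z 1 0.
Proof. by rewrite mxE big_ord2 !mxE. Qed.

Lemma cconj0 z : cconj z 0 0 = conjc (z 1 0).
Proof. by rewrite mx2_mul0 !mxE mul0r mul1r add0r. Qed.

Lemma cconj1 z : cconj z 1 0 = conjc (z 0 0).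
Proof. by rewrite mx2_mul1 !mxE mul0r mul1r addr0. Qed.

Lemma scale_entry c z i : (c *: z) i 0 = c * z i 0.
Proof. by rewrite !mxE. Qed.

Lemma spinor_addE z w i : (z + w) i 0 = z i 0 + w i 0.
Proof. by rewrite !mxE. Qed.

Lemma spinor_oppE z i : (- z) i 0 = - z i 0.
Proof. by rewrite !mxE. Qed.

Lemma spinor2_0 (a b : R[i]) : spinor2 a b 0 0 = a.
Proof. by rewrite mxE. Qed.

Lemma spinor2_1 (a b : R[i]) : spinor2 a b 1 0 = b.
Proof. by rewrite mxE. Qed.

Definition entryE := (mx2_mul0, mx2_mul1, cconj0, cconj1, scale_entry,
  spinor_addE, spinor_oppE, spinor2_0, spinor2_1).

Lemma conjcE (x y : R) : conjc (x +i* y)%C = (x +i* - y)%C. Proof. by []. Qed.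

Lemma addCE (x y x' y' : R) : ((x +i* y) + (x' +i* y') = (x + x') +i* (y + y'))%C.
Proof. by []. Qed.
Lemma oppCE (x y : R) : (- (x +i* y) = (- x) +i* (- y))%C.
Proof. by []. Qed.
Lemma mulCE (x y x' y' : R) :
  ((x +i* y) * (x' +i* y') = (x * x' - y * y') +i* (x * y' + y * x'))%C.
Proof. by []. Qed.
Definition complexE := (mulCE, addCE, oppCE, conjcE).

Lemma cconjD z w : cconj (z + w) = cconj z + cconj w.
Proof. by apply: spinorP; rewrite !entryE rmorphD. Qed.

Lemma cconjZ c z : cconj (c *: z) = conjc c *: cconj z.
Proof. by apply: spinorP; rewrite !entryE rmorphM. Qed.

Lemma cconjN z : cconj (- z) = - cconj z.
Proof. by apply: spinorP; rewrite !entryE rmorphN. Qed.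

Lemma cconjB z w : cconj (z - w) = cconj z - cconj w.
Proof. by rewrite cconjD cconjN. Qed.

Lemma cconjK : involutive cconj.
Proof. by move=> z; apply: spinorP; rewrite !entryE conjcK. Qed.

Lemma normsqE z : normsq z =
  (complex.Re (z 0 0)) ^+ 2 + (complex.Im (z 0 0)) ^+ 2
  + ((complex.Re (z 1 0)) ^+ 2 + (complex.Im (z 1 0)) ^+ 2).
Proof. by rewrite /normsq big_ord2. Qed.

Lemma normsq_cconj z : normsq (cconj z) = normsq z.
Proof.
rewrite !normsqE !entryE; case: (z 0 0) (z 1 0) => [a b] [c d] /=.
by rewrite !sqrrN addrC.
Qed.

Lemma conjcM (a b : R[i]) : conjc (a * b) = conjc a * conjc b.
Proof. exact: rmorphM. Qed.

Lemma conjcN (a : R[i]) : conjc (- a) = - conjc a.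
Proof. exact: rmorphN. Qed.

Lemma conjc_imag : conjc (imag R) = - imag R.
Proof. by rewrite /imag !complexE oppr0. Qed.

Lemma imag_sqr : imag R * imag R = -1.
Proof. by rewrite /imag !complexE; congr Complex; ring. Qed.

Lemma conjc_real (a : R) : conjc (a%:C)%C = (a%:C)%C.
Proof. by rewrite /= oppr0. Qed.

Lemma cconj_sigma1 z : cconj (sigma1 R *m z) = sigma1 R *m cconj z.
Proof.
by rewrite /sigma1; apply: spinorP; rewrite !entryE !mul0r !mul1r ?add0r ?addr0.
Qed.

Lemma cconj_sigma2 z : cconj (sigma2 R *m z) = sigma2 R *m cconj z.
Proof.
rewrite /sigma2; apply: spinorP;
  by rewrite !entryE !mul0r ?add0r ?addr0 conjcM ?conjcN conjc_imag ?opprK.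
Qed.

(** The sign appears here only: [sigma3] is real and anticommutes with [sigma1]. For [sigma2], the
    sign from conjugating its imaginary entries cancels the sign from anticommuting with
    [sigma1]. *)
Lemma cconj_sigma3 (z : spinor R) :
  cconj (sigma3 R *m z) = - (sigma3 R *m cconj z).
Proof.
rewrite /sigma3; apply: spinorP; rewrite !entryE !mul0r !mul1r ?add0r ?addr0 //.
  by rewrite mulN1r conjcN.
by rewrite mulN1r opprK.
Qed.

(** The conjugate of the factor - i and the passage through [sigma3] give two signs, which cancel;
    hence C preserves the boundary condition. *)
Lemma bmx_cconj (n : plane R) z : bmx n *m cconj z = cconj (bmx n *m z).
Proof.
rewrite /bmx -!scalemxAl cconjZ conjcN conjc_imag opprK -!mulmxA cconj_sigma3.
rewrite scalerN -scaleNr; congr (_ *: (_ *m _)).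
rewrite /sigma_dot !mulmxDl -!scalemxAl cconjD !cconjZ !conjc_real.
by rewrite cconj_sigma1 cconj_sigma2.
Qed.

(** Each term receives exactly one sign: the kinetic term from conjugating - i, the mass term from
    [sigma3]. *)
Lemma dirac_cconj (m : R) z g1 g2 :
  - imag R *: (sigma1 R *m cconj g1 + sigma2 R *m cconj g2)
    + (m%:C)%C *: (sigma3 R *m cconj z) =
  - cconj (- imag R *: (sigma1 R *m g1 + sigma2 R *m g2)
             + (m%:C)%C *: (sigma3 R *m z)).
Proof.
rewrite cconjD !cconjZ cconjD cconj_sigma1 cconj_sigma2 cconj_sigma3.
by rewrite conjcN conjc_imag conjc_real opprK opprD scaleNr scalerN opprK.
Qed.

End Conj.

(** * Charge conjugation and the Dirac operator *)

Section ChargeConjugation.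
Variable R : realType.

(** C exchanges the two components ([rev_ord] on ['I_2]) and negates imaginary parts. Measurability,
    smoothness and weak derivatives are all coordinatewise, so their invariance under C reduces to
    invariance under negation. *)
Lemma rcoord_cconj (T : Type) im (i : 'I_2) (u : T -> spinor R) :
  rcoord im i (fun x => cconj (u x)) =
  (fun x => if im then - rcoord im (rev_ord i) u x else rcoord im (rev_ord i) u x).
Proof.
apply/funext => x; rewrite /rcoord.
have r0 : rev_ord (0 : 'I_2) = 1 by apply/val_inj.
have r1 : rev_ord (1 : 'I_2) = 0 by apply/val_inj.
by elim/ord2P: i; rewrite ?r0 ?r1 !entryE; case: (u x _ _) => [a b]; case: im.
Qed.

Section L2.
Context d (T : measurableType d) (mu : {measure set T -> \bar R}) (A : set T).

Lemma L2_cconj (u : T -> spinor R) :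
  L2 mu A u -> L2 mu A (fun x => cconj (u x)).
Proof.
move=> [mu_ fu]; split; last by under eq_integral do rewrite normsq_cconj.
by move=> im i; rewrite rcoord_cconj; case: im; [exact: measurableT_comp|].
Qed.

Lemma L2_opp (u : T -> spinor R) : L2 mu A u -> L2 mu A (fun x => - u x).
Proof.
have N z : normsq (- z : spinor R) = normsq z.
  by rewrite !normsqE !spinor_oppE; case: (z 0 0) (z 1 0) => [a b] [c e] /=;
     rewrite !sqrrN.
move=> [mu_ fu]; split; last by under eq_integral do rewrite N.
move=> im i.
have -> : rcoord im i (fun x => - u x) = (fun x => - rcoord im i u x).
  by apply/funext => x; rewrite /rcoord spinor_oppE; case: (u x i 0) => a b; case: im.
exact: measurableT_comp.
Qed.

Lemma L2_cvg_cconj (u_ : nat -> T -> spinor R) (u : T -> spinor R) :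
  L2_cvg mu A u_ u ->
  L2_cvg mu A (fun n x => cconj (u_ n x)) (fun x => cconj (u x)).
Proof.
rewrite /L2_cvg => uv.
have -> : (fun n => \int[mu]_(x in A)
    (normsq (cconj (u_ n x) - cconj (u x)))%:E)%E =
  (fun n => \int[mu]_(x in A) (normsq (u_ n x - u x))%:E)%E.
  apply/funext => n; apply: eq_integral => x _.
  by rewrite -cconjB normsq_cconj.
exact: uv.
Qed.

(* Also when both parts have infinite integral: the junk value is then 0. *)
Lemma RintegralN (f : T -> R) :
  Rintegral mu A (fun x => - f x) = - Rintegral mu A f.
Proof.
rewrite /Rintegral integralE [in RHS]integralE.
have -> : (fun x : T => (- f x)%:E) = (\- (fun x => (f x)%:E))%E.
  by apply/funext => x /=; rewrite EFinN.
rewrite funeposN funenegN.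
set a := integral _ _ _; set b := integral _ _ _.
by case: a b => [a| |] [b| |] //=; rewrite ?oppr0 //= opprB.
Qed.

End L2.

Lemma smooth_iter_opp (f : R * R -> R) (s : seq (R * R)) : smooth f ->
  foldr (fun v h => 'D_v h) (fun x => - f x) s =
  (fun x => - foldr (fun v h => 'D_v h) f s x).
Proof.
move=> sf; elim: s => [//|v s ih] /=.
rewrite ih; apply/funext => x.
by rewrite deriveN //; apply: diff_derivable; exact: sf.
Qed.

Lemma test_fun_opp Om (f : R * R -> R) :
  test_fun Om f -> test_fun Om (fun x => - f x).
Proof.
move=> [sf cf suppf].
have -> : test_fun Om (fun x => - f x) =
  [/\ smooth (fun x => - f x), compact (fun_supp f) & fun_supp f `<=` Om].
  rewrite /test_fun.
  have -> // : fun_supp (fun x => - f x) = fun_supp f.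
  rewrite /fun_supp; congr closure; apply/seteqP.
  by split => x /=; rewrite oppr_eq0.
split => // s x; rewrite smooth_iter_opp //.
by apply: differentiableN; exact: sf.
Qed.

Lemma smooth_field_cconj (u : spinor_field R) :
  smooth_field u -> smooth_field (charge_conj u).
Proof.
move=> su im i; rewrite rcoord_cconj; case: im; last exact: (su false (rev_ord i)).
exact: (test_fun_opp (su true (rev_ord i))).
Qed.

Lemma smooth_field_derivable im i (u : spinor_field R) x v : smooth_field u ->
  derivable (rcoord im i u) x v.
Proof.
move=> su; apply: diff_derivable.
by have [sf _ _] := su im i; exact: (sf [::]).
Qed.

Lemma rcoord_deriv_field v (u : spinor_field R) im i :
  rcoord im i (deriv_field v u) = 'D_v (rcoord im i u).
Proof. by apply/funext => x; rewrite /rcoord /deriv_field mxE; case: im. Qed.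

Lemma rcoord_inj (T : Type) (u w : T -> spinor R) :
  (forall im i, rcoord im i u = rcoord im i w) -> u = w.
Proof.
move=> uw; apply/funext => x; apply/matrixP => i j; rewrite (ord1 j).
have := congr1 (@^~ x) (uw false i); have := congr1 (@^~ x) (uw true i).
by rewrite /rcoord; case: (u x i 0) (w x i 0) => [a b] [c d] /= -> ->.
Qed.

Lemma deriv_field_cconj v (u : spinor_field R) : smooth_field u ->
  deriv_field v (charge_conj u) = charge_conj (deriv_field v u).
Proof.
move=> su; apply: rcoord_inj => im i.
rewrite rcoord_deriv_field !rcoord_cconj; case: im; last first.
  by rewrite rcoord_deriv_field.
apply/funext => x; rewrite rcoord_deriv_field deriveN //.
exact: smooth_field_derivable.
Qed.

Lemma weak_deriv_cconj Om v (u g : spinor_field R) :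
  weak_deriv Om v u g -> weak_deriv Om v (charge_conj u) (charge_conj g).
Proof.
move=> ug f im i tf; rewrite !rcoord_cconj; case: im; last exact: (ug f false (rev_ord i)).
transitivity (- Rintegral (@lebesgue2 R) Om
    (fun x => rcoord true (rev_ord i) u x * 'D_v f x)).
  by rewrite -RintegralN; apply: eq_Rintegral => x _; rewrite mulNr.
rewrite (ug f true (rev_ord i) tf); congr (- _).
by rewrite -RintegralN; apply: eq_Rintegral => x _; rewrite mulNr.
Qed.

Lemma H1_grad_cconj Om (u g1 g2 : spinor_field R) : H1_grad Om u g1 g2 ->
  H1_grad Om (charge_conj u) (charge_conj g1) (charge_conj g2).
Proof.
by move=> [? ? ? ? ?]; split; try exact: weak_deriv_cconj; exact: L2_cconj.
Qed.

Lemma is_trace_cconj om (u : spinor_field R) t : is_trace om u t ->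
  is_trace om (charge_conj u) (fun s r => cconj (t s r)).
Proof.
move=> [phi [g1 [g2 [sphi ug [c0 c1 c2] tr]]]].
exists (fun n => charge_conj (phi n)), (charge_conj g1), (charge_conj g2); split.
- by move=> n; exact: smooth_field_cconj.
- exact: H1_grad_cconj.
- split; first exact: L2_cvg_cconj.
  + rewrite (_ : (fun n => _) = fun n => charge_conj (deriv_field (e1 R) (phi n))).
      exact: L2_cvg_cconj.
    by apply/funext => n; rewrite deriv_field_cconj.
  + rewrite (_ : (fun n => _) = fun n => charge_conj (deriv_field (e2 R) (phi n))).
      exact: L2_cvg_cconj.
    by apply/funext => n; rewrite deriv_field_cconj.
- move=> s; have [? ?] := tr s; split; first exact: L2_cconj.
  exact: L2_cvg_cconj.
Qed.

Lemma boundary_cond_cconj om (u : spinor_field R) :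
  boundary_cond om u -> boundary_cond om (charge_conj u).
Proof.
move=> [t tru bt]; exists (fun s r => cconj (t s r)).
  exact: is_trace_cconj.
move=> s; apply: filterS (bt s) => r /= tr hr.
by rewrite bmx_cconj tr.
Qed.

Lemma dirac_op_cconj om m (u f : spinor_field R) : dirac_op om m (u, f) ->
  dirac_op om m (charge_conj u, fun x => - charge_conj f x).
Proof.
move=> [/= L2f [g1 [g2 [ug bu fE]]]]; split => /=.
  by apply: L2_opp; exact: L2_cconj.
exists (charge_conj g1), (charge_conj g2); split.
- exact: H1_grad_cconj.
- exact: boundary_cond_cconj.
- apply: filterS fE => x /= fx wx; rewrite dirac_cconj.
  by rewrite /charge_conj fx.
Qed.

End ChargeConjugation.

(** * Charge conjugation and the extensions D^gamma *)

Section ChargeConjugationExt.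
Variable R : realType.
Implicit Types (om m : R) (gamma : R[i]).

Lemma conjc_cis a : conjc (cis a : R[i]) = cis (- a).
Proof. by rewrite /cis conjcE cosN sinN. Qed.

Lemma cconj_u0 om t : cconj (u0 om t) = imag R *: u0 om t.
Proof.
rewrite /u0 cconjZ conjc_real [RHS]scalerA [imag R * _]mulrC -[RHS]scalerA; congr (_ *: _).
apply: spinorP; rewrite !entryE ?conjcM ?conjcN !conjc_cis ?conjc_imag ?opprK //.
by rewrite [RHS]mulrA mulrN imag_sqr opprK mul1r.
Qed.

Lemma cconj_um1 om t : cconj (um1 om t) = - imag R *: um1 om t.
Proof.
rewrite /um1 cconjZ conjc_real [RHS]scalerA [- imag R * _]mulrC -[RHS]scalerA; congr (_ *: _).
apply: spinorP; rewrite !entryE ?conjcM ?conjcN !conjc_cis ?conjc_imag ?opprK //.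
by rewrite [RHS]mulrA mulNr imag_sqr opprK mul1r.
Qed.

(** C multiplies [u0] by i and [um1] by - i; the coefficient of [um1] is purely imaginary, so its
    conjugation brings the missing sign and both summands are multiplied by i. *)
Lemma cconj_vplus om x : cconj (vplus om x) = imag R *: vplus om x.
Proof.
rewrite /vplus; have := cconj_um1 om (angle x); have := cconj_u0 om (angle x).
move: (besselK _ _) (besselK _ _) (u0 _ _) (um1 _ _) => k l p q hp hq.
rewrite cconjB !cconjZ conjcM !conjc_real conjc_imag hp hq scalerBr !scalerA.
by rewrite [_ * imag R]mulrC mulNr mulrNN [imag R * _ * _]mulrC.
Qed.

Lemma cconj_vminus om x : cconj (vminus om x) = imag R *: vminus om x.
Proof.
rewrite /vminus; have := cconj_um1 om (angle x); have := cconj_u0 om (angle x).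
move: (besselK _ _) (besselK _ _) (u0 _ _) (um1 _ _) => k l p q hp hq.
rewrite cconjD !cconjZ conjcM !conjc_real conjc_imag hp hq scalerDr !scalerA.
by rewrite [_ * imag R]mulrC mulNr mulrNN [imag R * _ * _]mulrC.
Qed.

Lemma cconj_deficiency (p q : spinor R) (c g : R[i]) :
  cconj p = imag R *: p -> cconj q = imag R *: q ->
  cconj (c *: (p + g *: q)) = (imag R * conjc c) *: (p + conjc g *: q).
Proof.
move=> hp hq; rewrite cconjZ cconjD cconjZ hp hq [imag R * _]mulrC -[RHS]scalerA.
congr (_ *: _); rewrite [RHS]scalerDr; congr (_ + _).
by rewrite [LHS]scalerA [RHS]scalerA mulrC.
Qed.

(** The leading minus sign is absorbed by the conjugation of i in the first term and by [sigma3] in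
    the second. The common factor i of p and q goes into c, so that only g changes. *)
Lemma cconj_deficiency_image (m : R) (p q : spinor R) (c g : R[i]) :
  cconj p = imag R *: p -> cconj q = imag R *: q ->
  - cconj (c *: (imag R *: (p - g *: q) + (m%:C)%C *: (sigma3 R *m (p + g *: q))))
  = (imag R * conjc c) *:
    (imag R *: (p - conjc g *: q) + (m%:C)%C *: (sigma3 R *m (p + conjc g *: q))).
Proof.
move=> hp hq; rewrite cconjZ cconjD (cconjZ (imag R)) (cconjZ (m%:C)%C).
rewrite cconj_sigma3 conjc_imag conjc_real.
have := cconj_deficiency 1 g hp hq; rewrite !scale1r => ->.
have := cconj_deficiency 1 (- g) hp hq; rewrite !scale1r !scaleNr => ->.
rewrite rmorph1 mulr1 conjcN scaleNr -scalemxAr.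
move: (sigma3 R *m _) (p - _) => w z.
rewrite [imag R * _]mulrC -[RHS]scalerA -[LHS]scalerN; congr (_ *: _).
rewrite !scalerN -opprD opprK [RHS]scalerDr; congr (_ + _).
by rewrite [LHS]scalerA [RHS]scalerA mulrC.
Qed.

Lemma dirac_ext_cconj om m gamma (u f : spinor_field R) :
  dirac_ext om m gamma (u, f) ->
  dirac_ext om m (conjc gamma) (charge_conj u, fun x => - charge_conj f x).
Proof.
move=> [/= L2u L2f [v [h [c [vh uE fE]]]]]; split => /=.
- exact: L2_cconj.
- by apply: L2_opp; exact: L2_cconj.
exists (charge_conj v), (fun x => - charge_conj h x), (imag R * conjc c); split.
- exact: dirac_op_cconj.
- apply: filterS uE => x ux wx; rewrite /charge_conj -/(cconj _) ux //.
  rewrite cconjD -/(cconj (v x)); congr (_ + _).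
  by apply: cconj_deficiency; [exact: cconj_vplus|exact: cconj_vminus].
- apply: filterS fE => x fx wx; rewrite /charge_conj -/(cconj _) fx //.
  rewrite cconjD -/(cconj (h x)) opprD; congr (_ + _).
  by apply: cconj_deficiency_image; [exact: cconj_vplus|exact: cconj_vminus].
Qed.

Lemma charge_conjK : involutive (@charge_conj R).
Proof. by move=> u; apply/funext => x; exact: cconjK. Qed.

(** One inclusion, known for every parameter, gives both: C and the conjugation of gamma are
    involutions. *)
Lemma charge_conj_domain_ext om m gamma :
  @charge_conj R @` op_domain (dirac_ext om m gamma) =
  op_domain (dirac_ext om m (conjc gamma)).
Proof.
have sub g : @charge_conj R @` op_domain (dirac_ext om m g) `<=`
    op_domain (dirac_ext om m (conjc g)).
  move=> _ [_ [[u f] /= uf <-] <-].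
  by exists (charge_conj u, fun x => - charge_conj f x); [|by []];
    exact: dirac_ext_cconj.
apply/seteqP; split; first exact: sub.
move=> u Du; exists (charge_conj u); last exact: charge_conjK.
by rewrite -[gamma]conjcK; apply: sub; exists u.
Qed.

Lemma dirac_ext_anticommutes om m gamma : conjc gamma = gamma ->
  C_anticommutes om (dirac_ext om m gamma).
Proof.
move=> cg u f uf; exists (fun x => - charge_conj f x).
  by rewrite -[X in dirac_ext _ _ X]cg; exact: dirac_ext_cconj.
by apply: nearW => x _ /=; rewrite subrr.
Qed.

Lemma dirac_ext_C_invariant om m gamma : conjc gamma = gamma ->
  C_invariant (dirac_ext om m gamma).
Proof. by move=> cg; rewrite /C_invariant charge_conj_domain_ext cg. Qed.

End ChargeConjugationExt.

(** * Integration tools *)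

Section IntegralTools.
Variable R : realType.
Local Notation mu := (@lebesgue_measure R).

Section RealIntegrands.
Context d (T : measurableType d) (nu : {measure set T -> \bar R}) (D : set T).
Hypothesis mD : measurable D.
Implicit Types f g p q : T -> R.

Lemma measurable_fun_expR f :
  measurable_fun D f -> measurable_fun D (fun x => expR (f x)).
Proof. by move=> mf; apply: measurableT_comp. Qed.

Lemma integral_EFin_ge0 f : (forall x, D x -> 0 <= f x) ->
  (0 <= \int[nu]_(x in D) (f x)%:E)%E.
Proof. by move=> f0; apply: integral_ge0 => x Dx; rewrite lee_fin f0. Qed.

Lemma integral_EFin_le f g : measurable_fun D f -> measurable_fun D g ->
  (forall x, D x -> 0 <= f x) -> (forall x, D x -> f x <= g x) ->
  (\int[nu]_(x in D) (f x)%:E <= \int[nu]_(x in D) (g x)%:E)%E.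
Proof.
by move=> mf mg f0 fg; apply: ge0_le_integral => //; exact/measurable_EFinP.
Qed.

Lemma integral_EFinZl (c : R) f : measurable_fun D f ->
  (forall x, D x -> 0 <= f x) -> 0 <= c ->
  (\int[nu]_(x in D) (c * f x)%:E = c%:E * \int[nu]_(x in D) (f x)%:E)%E.
Proof.
move=> mf f0 c0; under eq_integral do rewrite EFinM.
by rewrite ge0_integralZl_EFin //; exact/measurable_EFinP.
Qed.

Lemma integral_EFinD f g : measurable_fun D f -> measurable_fun D g ->
  (forall x, D x -> 0 <= f x) -> (forall x, D x -> 0 <= g x) ->
  (\int[nu]_(x in D) (f x + g x)%:E =
   \int[nu]_(x in D) (f x)%:E + \int[nu]_(x in D) (g x)%:E)%E.
Proof.
move=> mf mg f0 g0; under eq_integral do rewrite EFinD.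
by rewrite ge0_integralD //; exact/measurable_EFinP.
Qed.

(* Cauchy-Schwarz against the weight p, from 2 a b <= a^2 q + b^2 p for
   p q = 1. *)
Lemma sqr_Rintegral_le f p q :
  measurable_fun D f -> measurable_fun D p -> measurable_fun D q ->
  (forall x, D x -> 0 <= f x) ->
  (forall x, D x -> 0 < p x) -> (forall x, D x -> p x * q x = 1) ->
  (\int[nu]_(x in D) (p x)%:E <= 1)%E ->
  (((Rintegral nu D f) ^+ 2)%:E <= \int[nu]_(x in D) (f x ^+ 2 * q x)%:E)%E.
Proof.
move=> mf mp mq f0 p0 pq p1.
have q0 x : D x -> 0 < q x.
  by move=> Dx; have := pq _ Dx; have := p0 _ Dx => ? h; nra.
have f2q0 x : D x -> 0 <= f x ^+ 2 * q x.
  by move=> Dx; rewrite mulr_ge0 ?sqr_ge0 ?ltW ?q0.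
have fI := integral_EFin_ge0 f0; have f2qI := integral_EFin_ge0 f2q0.
(* If f has infinite integral, [Rintegral] takes the default value 0 and the bound is trivial. *)
have [If|If] := eqVneq (\int[nu]_(x in D) (f x)%:E)%E +oo%E.
  by rewrite /Rintegral If /= expr0n.
set c := Rintegral nu D f.
have c0 : 0 <= c by rewrite fine_ge0.
have cE : (\int[nu]_(x in D) (f x)%:E)%E = c%:E.
  by rewrite /c /Rintegral fineK // ge0_fin_numE // ltey.
have mfq : measurable_fun D (fun x => f x ^+ 2 * q x).
  by apply: measurable_funM => //; apply: measurable_funX.
(* Integrating 2 c f <= f^2 q + c^2 p, with c the integral of f, gives 2 c^2 <= I + c^2 P where P <=
   1, that is c^2 <= I. *)
have : (\int[nu]_(x in D) (2 * c * f x)%:E <=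
        \int[nu]_(x in D) (f x ^+ 2 * q x + c ^+ 2 * p x)%:E)%E.
  apply: integral_EFin_le.
  - exact: measurable_funM.
  - by apply: measurable_funD => //; apply: measurable_funM.
  - by move=> x Dx; rewrite !mulr_ge0 ?f0.
  move=> x Dx.
  have := pq _ Dx; have := p0 _ Dx; have := q0 _ Dx.
  move: (f x) (p x) (q x) => a b e e0 b0 be.
  have -> : a ^+ 2 * e + c ^+ 2 * b = 2 * c * a + e * (a - c * b) ^+ 2.
    have -> : e * (a - c * b) ^+ 2 =
      a ^+ 2 * e - 2 * c * a * (b * e) + c ^+ 2 * b * (b * e) by ring.
    by rewrite be; ring.
  by rewrite lerDl mulr_ge0 ?sqr_ge0 ?ltW.
rewrite integral_EFinZl ?mulr_ge0 // cE -EFinM integral_EFinD //; last 2 first.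
- exact: measurable_funM.
- by move=> x Dx; rewrite mulr_ge0 ?sqr_ge0 ?ltW ?p0.
have p0' x : D x -> 0 <= p x by move=> /p0 /ltW.
rewrite integral_EFinZl ?sqr_ge0 //.
have P0 := integral_EFin_ge0 p0'.
case: (\int[nu]_(x in D) (f x ^+ 2 * q x)%:E)%E f2qI => [I| |] //= I0; last by rewrite leey.
move: P0 p1; case: (\int[nu]_(x in D) (p x)%:E)%E => [P| |] //=.
rewrite !lee_fin => P0 P1 h.
have := sqr_ge0 c; nra.
Qed.

End RealIntegrands.

(** The exponential density a e^(- a t) has total mass 1. *)
Lemma integral_expR_decay (a : R) : 0 < a ->
  (\int[mu]_(t in `[0%R, +oo[) (expR (- a * t))%:E = (a^-1)%:E)%E.
Proof.
move=> a0; have := integral_exponential_pdf a0.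
have -> : (fun x => (exponential_pdf a x)%:E) =
  ((fun x => (a%:E * (expR (- a * x))%:E)%E) \_ `[(0 : R), +oo[%classic).
  apply/funext => x; rewrite /exponential_pdf !patchE; case: ifP => // _.
rewrite -integral_mkcond ge0_integralZl_EFin ?ltW //; last first.
  apply/measurable_EFinP; apply: measurable_fun_expR.
  exact: measurable_funM.
case: (\int[mu]_(t in _) _)%E => [I| |].
- by rewrite -EFinM => -[h]; congr (_%:E); rewrite -[LHS](mulKf (lt0r_neq0 a0)) h mulr1.
- by rewrite gt0_muley ?lte_fin.
- by rewrite gt0_muleNy ?lte_fin.
Qed.

Lemma integral_expR_abs (a : R) : 0 < a ->
  (\int[mu]_t (expR (- a * `|t|))%:E = (2 * a^-1)%:E)%E.
Proof.
move=> a0; rewrite ge0_symfun_integralT.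
- rewrite EFinM -integral_expR_decay // set_itvcy; congr (_ * _)%E.
  by apply: eq_integral => t; rewrite inE /= => t0; rewrite ger0_norm.
- by move=> x; exact: expR_ge0.
- move=> x; apply: continuous_comp; last exact: continuous_expR.
  apply: continuousM; first exact: cst_continuous.
  exact: norm_continuous.
- by move=> x /=; rewrite normrN.
Qed.

End IntegralTools.

(** * The Bessel functions *)

Section Tonelli.
Context d1 d2 (T1 : measurableType d1) (T2 : measurableType d2) (R : realType).
Variables (m1 : {sigma_finite_measure set T1 -> \bar R})
  (m2 : {sigma_finite_measure set T2 -> \bar R}).
Variables (D : set T2) (H : T1 * T2 -> R).
Hypotheses (mD : measurable D) (mH : measurable_fun setT H) (H0 : forall z, 0 <= H z).

(** The restriction of the second variable to D becomes a factor, so that Tonelli is applied on the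
    full product. *)
Let HD z := (H z * \1_D z.2)%:E.

Let HD0 z : (0 <= HD z)%E.
Proof. by rewrite lee_fin mulr_ge0. Qed.

Let mHD : measurable_fun setT HD.
Proof.
apply/measurable_EFinP/measurable_funM => //.
have m1D : measurable_fun setT (\1_D : T2 -> R) by exact: measurable_indic.
exact: (measurableT_comp m1D measurable_snd).
Qed.

Let HDE x : (\int[m2]_(t in D) (H (x, t))%:E = \int[m2]_t HD (x, t))%E.
Proof.
rewrite integral_mkcond; apply: eq_integral => t _.
by rewrite patchE /HD indicE /=; case: ifP => _; rewrite ?mulr1 ?mulr0.
Qed.

Lemma measurable_integral_snd :
  measurable_fun setT (fun x => \int[m2]_(t in D) (H (x, t))%:E)%E.
Proof.
rewrite (_ : (fun x => _) = (fun x => \int[m2]_t HD (x, t))%E).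
  exact: (measurable_fun_fubini_tonelli_F HD mHD HD0).
by apply/funext => x; exact: HDE.
Qed.

Lemma tonelli_snd :
  (\int[m1]_x \int[m2]_(t in D) (H (x, t))%:E =
   \int[m2]_(t in D) \int[m1]_x (H (x, t))%:E)%E.
Proof.
under eq_integral do rewrite HDE.
rewrite (fubini_tonelli HD mHD HD0) [RHS]integral_mkcond.
apply: eq_integral => t _; rewrite patchE; case: ifP => tD.
  by apply: eq_integral => x _; rewrite /HD indicE /= tD mulr1.
rewrite -[RHS](integral0 m1 setT).
by apply: eq_integral => x _; rewrite /HD indicE /= tD mulr0.
Qed.

End Tonelli.

Section Bessel.
Variable R : realType.
Local Notation mu := (@lebesgue_measure R).
Implicit Types (t r nu a : R).

Lemma coshN t : cosh (- t) = cosh t.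
Proof. by rewrite /cosh opprK addrC. Qed.

Lemma cosh_ge t : expR t / 2 <= cosh t.
Proof. by rewrite /cosh ler_pM2r // lerDl expR_ge0. Qed.

Lemma cosh_ge0 t : 0 <= cosh t.
Proof. by rewrite /cosh divr_ge0 ?addr_ge0 ?expR_ge0. Qed.

Lemma cosh_le t : 0 <= t -> cosh t <= expR t.
Proof.
move=> t0; rewrite /cosh ler_pdivrMr // mulr_natr mulr2n lerD2l ler_expR; lra.
Qed.

Lemma measurable_cosh : measurable_fun setT (@cosh R).
Proof.
apply: measurable_funM => //; apply: measurable_funD => //.
exact: measurable_fun_expR.
Qed.

Lemma measurable_fun_cosh d (T : measurableType d) D (f : T -> R) :
  measurable_fun D f -> measurable_fun D (fun x => cosh (f x)).
Proof. by move=> mf; apply: (measurableT_comp measurable_cosh). Qed.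

(** Since cosh is even, the negative order nu0 is brought into the range 0 <= nu < 1 of the
    estimates. *)
Lemma besselK_norm nu r : besselK nu r = besselK `|nu| r.
Proof.
have [nu0|nu0] := leP 0 nu; first by rewrite ger0_norm.
rewrite ltr0_norm // /besselK; apply: eq_Rintegral => t _.
by rewrite [- nu * t]mulNr coshN.
Qed.

Definition besselK_integrand nu r t : R := expR (- r * cosh t) * cosh (nu * t).

Lemma besselK_integrand_ge0 nu r t : 0 <= besselK_integrand nu r t.
Proof. by rewrite mulr_ge0 ?expR_ge0 ?cosh_ge0. Qed.

Lemma measurable_besselK_integrand nu :
  measurable_fun setT (fun z : measurableTypeR R * measurableTypeR R =>
    besselK_integrand nu z.1 z.2).
Proof.
have m1 : measurable_fun setT (fst : measurableTypeR R * measurableTypeR R -> _).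
  exact: measurable_fst.
have m2 : measurable_fun setT (snd : measurableTypeR R * measurableTypeR R -> _).
  exact: measurable_snd.
apply: measurable_funM.
  apply: measurable_fun_expR; apply: measurable_funM; last exact: measurable_fun_cosh.
  exact: measurableT_comp.
by apply: measurable_fun_cosh; apply: measurable_funM.
Qed.

Lemma measurable_besselK_integrand2 nu r :
  measurable_fun setT (besselK_integrand nu r : measurableTypeR R -> R).
Proof. exact: (measurable_fun_pair2 r (measurable_besselK_integrand nu)). Qed.

Lemma measurable_besselK nu : measurable_fun setT (besselK nu : measurableTypeR R -> R).
Proof.
apply: (@measurableT_comp _ _ _ _ _ _ fine) => //.
apply: (@measurable_integral_snd _ _ _ _ _ mu `[0, +oo[%classic
  (fun z => besselK_integrand nu z.1 z.2)) => //.
- exact: measurable_besselK_integrand.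
- by move=> z; exact: besselK_integrand_ge0.
Qed.

(** The integrand is dominated by (2 / r) e^(- (1 - nu) t), which is integrable for nu < 1.
    Finiteness matters because [Rintegral] would read an infinite integral as 0, which would ruin
    lower bounds on [besselK]. *)
Lemma besselK_integral_fin nu r : 0 <= nu < 1 -> 0 < r ->
  (\int[mu]_(t in `[0%R, +oo[) (besselK_integrand nu r t)%:E)%E \is a fin_num.
Proof.
move=> /andP[nu0 nu1] r0.
have I0 : (0 <= \int[mu]_(t in `[0%R, +oo[) (besselK_integrand nu r t)%:E)%E.
  by apply: integral_EFin_ge0 => t _; exact: besselK_integrand_ge0.
rewrite ge0_fin_numE //.
apply: (@le_lt_trans _ _
  (\int[mu]_(t in `[0%R, +oo[) (2 / r * expR (- (1 - nu) * t))%:E)%E); last first.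
  rewrite integral_EFinZl //.
  - by rewrite integral_expR_decay ?subr_gt0 // -EFinM ltry.
  - by apply: measurable_fun_expR; exact: measurable_funM.
  - by rewrite divr_ge0 // ltW.
apply: integral_EFin_le => //.
- by apply: measurable_funTS; exact: measurable_besselK_integrand2.
- apply: measurable_funM => //.
  by apply: measurable_fun_expR; exact: measurable_funM.
- by move=> t _; exact: besselK_integrand_ge0.
move=> t; rewrite /= in_itv /= andbT => t0.
have -> : - (1 - nu) * t = - t + nu * t by ring.
rewrite expRD mulrA; apply: ler_pM.
- exact: expR_ge0.
- exact: cosh_ge0.
(* With z = r e^t / 2 <= r cosh t, the bound is e^(- z) <= 1 / z. *)
- have z0 : 0 < r * (expR t / 2) by rewrite mulr_gt0 // divr_gt0 // expR_gt0.
  have h : r * (expR t / 2) <= expR (r * (expR t / 2)).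
    by apply: le_trans (expR_ge1Dx _); rewrite lerDr.
  apply: (@le_trans _ _ (expR (- (r * (expR t / 2))))).
    by rewrite ler_expR mulNr lerN2 ler_pM2l // cosh_ge.
  have -> : 2 / r * expR (- t) = (r * (expR t / 2))^-1.
    by rewrite expRN; field; rewrite ?lt0r_neq0 ?expR_gt0.
  by rewrite expRN lef_pV2 // posrE expR_gt0.
- by apply: cosh_le; rewrite mulr_ge0.
Qed.

(** Growth of order r^(- nu) at 0, read off the unit interval L - 1 <= t <= L: there r cosh t <= r
    e^L <= 3 and cosh(nu t) >= e^(nu (L - 1)) / 2. The condition 1 <= L keeps this interval in the
    domain of integration. *)
Lemma besselK_ge nu r L : 0 <= nu < 1 -> 1 <= L -> 0 < r <= 3 * expR (- L) ->
  expR (- 3 - nu) / 2 * expR (nu * L) <= besselK nu r.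
Proof.
move=> nu01 L1 /andP[r0 rL]; have /andP[nu0 nu1] := nu01.
set c := _ * expR _.
have c0 : 0 <= c by rewrite mulr_ge0 ?divr_ge0 ?expR_ge0.
have fK := besselK_integral_fin nu01 r0.
rewrite -lee_fin /besselK /Rintegral fineK //.
have -> : c%:E = (\int[mu]_(t in `[(L - 1)%R, L]) (cst c%:E) t)%E.
  rewrite integral_cst //= lebesgue_measure_itv /= lte_fin ltrBlDr ltrDl ltr01.
  by rewrite -EFinB opprB addrC subrK mule1.
apply: (@le_trans _ _
   (\int[mu]_(t in `[(L - 1)%R, L]) (besselK_integrand nu r t)%:E)%E).
  apply: integral_EFin_le => //.
  - by apply: measurable_funTS; exact: measurable_besselK_integrand2.
  move=> t; rewrite /= in_itv /= => /andP[tL1 tL].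
  have -> : c = expR (- 3) * (expR (nu * (L - 1)) / 2).
    rewrite /c [_ * (_ / 2)]mulrA -expRD mulrAC -expRD; congr (expR _ / 2); ring.
  apply: ler_pM; rewrite ?expR_ge0 ?divr_ge0 ?expR_ge0 //.
    rewrite ler_expR mulNr lerN2.
    apply: (@le_trans _ _ (3 * expR (- L) * expR t)).
      have t0 : 0 <= t by lra.
      by apply: ler_pM => //; [exact: ltW|exact: cosh_ge0|exact: cosh_le].
    by rewrite -mulrA -expRD ger_pMr // expR_le1; lra.
  apply: le_trans (cosh_ge _).
  by rewrite ler_pM2r // ler_expR ler_wpM2l.
apply: ge0_subset_integral => //.
- apply/measurable_EFinP; apply: measurable_funTS.
  exact: measurable_besselK_integrand2.
- by move=> t _; rewrite lee_fin; exact: besselK_integrand_ge0.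
- by move=> t; rewrite /= !in_itv /= andbT => /andP[h _]; lra.
Qed.

End Bessel.

(** * Square integrability of K_nu(r) on the plane *)

Section BesselL2.
Variable R : realType.
Local Notation mu := (@lebesgue_measure R).
Local Notation T2 := (measurableTypeR R * measurableTypeR R)%type.
Implicit Types (t r nu : R).

Lemma lebesgue2_tonelli (f : T2 -> \bar R) :
  measurable_fun setT f -> (forall z, 0 <= f z)%E ->
  (\int[lebesgue2 R]_z f z = \int[mu]_x \int[mu]_y f (x, y))%E.
Proof. by move=> mf f0; exact: (@fubini_tonelli1 _ _ _ _ _ mu mu f mf f0). Qed.

Lemma measurable_radius : measurable_fun setT (@radius R : T2 -> R).
Proof.
have ms : measurable_fun setT (Num.sqrt : R -> R).
  by apply: continuous_measurable_fun; exact: sqrt_continuous.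
apply: (measurableT_comp ms (g := fun z : T2 => z.1 ^+ 2 + z.2 ^+ 2)).
apply: measurable_funD; apply: measurable_funX.
  exact: measurable_fst.
exact: measurable_snd.
Qed.

Lemma radius_ge0 (z : R * R) : 0 <= radius z.
Proof. exact: sqrtr_ge0. Qed.

Lemma radius_ge1 (z : R * R) : `|z.1| <= radius z.
Proof.
by rewrite -sqrtr_sqr ler_wsqrtr // lerDl sqr_ge0.
Qed.

Lemma radius_ge2 (z : R * R) : `|z.2| <= radius z.
Proof.
by rewrite -sqrtr_sqr ler_wsqrtr // lerDr sqr_ge0.
Qed.

(* The weight is p t = (1 - nu) e^(-(1 - nu) t); the bounds cosh t >= e^t / 2 and
   2 r >= |x| + |y| make the right-hand side a product in x and y. *)
Lemma besselK_sqr_le nu (x y : R) : 0 <= nu < 1 ->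
  (((besselK nu (radius (x, y))) ^+ 2)%:E <= \int[mu]_(t in `[0%R, +oo[)
    ((1 - nu)^-1 * expR ((1 + nu) * t) * expR (- (expR t / 2) * `|x|)
     * expR (- (expR t / 2) * `|y|))%:E)%E.
Proof.
move=> /andP[nu0 nu1]; set r := radius _.
have r0 : 0 <= r by exact: radius_ge0.
pose a := 1 - nu; have a0 : 0 < a by rewrite subr_gt0.
have mexp (c : R) : measurable_fun setT (fun t : measurableTypeR R => expR (c * t)).
  by apply: measurable_fun_expR; exact: measurable_funM.
apply: (@le_trans _ _ (\int[mu]_(t in `[0%R, +oo[)
    (besselK_integrand nu r t ^+ 2 * (a^-1 * expR (a * t)))%:E)%E).
  apply: (@sqr_Rintegral_le _ _ _ mu _ _ _ (fun t => a * expR (- a * t))) => //.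
  - by apply: measurable_funTS; exact: measurable_besselK_integrand2.
  - by apply: measurable_funM => //; apply: measurable_funTS.
  - by apply: measurable_funM => //; apply: measurable_funTS.
  - by move=> t _; exact: besselK_integrand_ge0.
  - by move=> t _; rewrite mulr_gt0 ?expR_gt0.
  - move=> t _; rewrite mulrACA -expRD mulNr addNr expR0 mulr1.
    by rewrite divff ?lt0r_neq0.
  - rewrite integral_EFinZl //; [|exact: measurable_funTS|exact: ltW].
    by rewrite integral_expR_decay // -EFinM divff ?lt0r_neq0.
apply: integral_EFin_le => //.
- apply: measurable_funM; last by apply: measurable_funM => //; apply: measurable_funTS.
  by apply: measurable_funX; apply: measurable_funTS; exact: measurable_besselK_integrand2.
- have mE (c : R) : measurable_fun setT
     (fun t : measurableTypeR R => expR (- (expR t / 2) * c)).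
    apply: measurable_fun_expR; apply: measurable_funM => //.
    apply: measurableT_comp => //; apply: measurable_funM => //.
  apply: measurable_funTS; apply: measurable_funM => //.
  by apply: measurable_funM => //; apply: measurable_funM.
- move=> t _; rewrite mulr_ge0 ?sqr_ge0 //.
  by rewrite mulr_ge0 ?expR_ge0 ?invr_ge0 ?ltW.
move=> t; rewrite /= in_itv /= andbT => t0.
set b := besselK_integrand nu r t; set X := expR (_ * `|x|).
set Y := expR (_ * `|y|); set N := expR ((1 + nu) * t).
have -> : b ^+ 2 * (a^-1 * expR (a * t)) = a^-1 * (b ^+ 2 * expR (a * t)) by ring.
have -> : (1 - nu)^-1 * N * X * Y = a^-1 * (N * X * Y) by rewrite /a; ring.
rewrite ler_pM2l ?invr_gt0 // {}/X {}/Y {}/N.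
apply: (@le_trans _ _ (expR (2%:R * (- r * cosh t)) * expR (2%:R * (nu * t)) * expR (a * t))).
  rewrite {}/b /besselK_integrand exprMn ler_wpM2r ?expR_ge0 //.
  rewrite !expRM_natl ler_wpM2l ?sqr_ge0 //.
  by rewrite ler_pXn2r // ?nnegrE ?cosh_ge0 ?expR_ge0 // cosh_le // mulr_ge0.
rewrite -!expRD ler_expR /a.
have -> : 2 * (- r * cosh t) + 2 * (nu * t) + (1 - nu) * t =
   (1 + nu) * t - r * (2 * cosh t) by ring.
rewrite -[leRHS]addrA lerD2l.
have ct := cosh_ge t; have e0 := expR_ge0 t.
have := radius_ge1 (x, y); have := radius_ge2 (x, y); rewrite /= -/r.
have := normr_ge0 x; have := normr_ge0 y.
move: `|x| `|y| (expR t) (cosh t) e0 ct => X Y e c e0 ec Y0 X0 Yr Xr.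
have : r * e <= r * (2 * c) by rewrite ler_wpM2l //; lra.
have : (X + Y) * e <= 2 * r * e by rewrite ler_wpM2r //; lra.
lra.
Qed.

(** After two exchanges of integrals, first of y and t at fixed x, then of x and t, the integrals in
    x and in y of e^(- (e^t / 2) |x|) and its analogue each contribute 4 e^(- t). What remains is a
    multiple of e^((1 + nu) t - 2 t) = e^(- (1 - nu) t). *)
Lemma integral_besselK_sqr nu : 0 <= nu < 1 ->
  (\int[lebesgue2 R]_z ((besselK nu (radius z)) ^+ 2)%:E < +oo)%E.
Proof.
move=> nu01; have /andP[nu0 nu1] := nu01.
pose a := 1 - nu; have a0 : 0 < a by rewrite subr_gt0.
have mK : measurable_fun setT (fun z : T2 => besselK nu (radius z) ^+ 2).
  apply: measurable_funX.
  exact: (measurableT_comp (measurable_besselK nu) measurable_radius).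
have m1 : measurable_fun setT (fst : T2 -> R) by exact: measurable_fst.
have m2 : measurable_fun setT (snd : T2 -> R) by exact: measurable_snd.
pose A t := a^-1 * expR ((1 + nu) * t).
pose E (x t : R) := expR (- (expR t / 2) * `|x|).
have A0 t : 0 <= A t by rewrite mulr_ge0 ?expR_ge0 ?invr_ge0 ?ltW.
have E0 x t : 0 <= E x t by exact: expR_ge0.
have mA : measurable_fun setT (fun z : T2 => A z.2).
  by apply: measurable_funM => //; apply: measurable_fun_expR; apply: measurable_funM.
have mE : measurable_fun setT (fun z : T2 => E z.1 z.2).
  apply: measurable_fun_expR; apply: measurable_funM; last exact: measurableT_comp.
  apply: measurableT_comp => //; apply: measurable_funM => //.
  exact: measurable_fun_expR.
have mE1 x : measurable_fun setT (fun z : T2 => E x z.2).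
  apply: measurable_fun_expR; apply: measurable_funM => //.
  apply: measurableT_comp => //; apply: measurable_funM => //.
  exact: measurable_fun_expR.
have slice1 (F : R -> R -> R) (t : R) : measurable_fun setT (fun z : T2 => F z.1 z.2) ->
    measurable_fun setT (F^~ t : measurableTypeR R -> R).
  by move=> mF; exact: (measurable_fun_pair1 t mF).
have IE t : (\int[mu]_y (E y t)%:E = (4 * expR (- t))%:E)%E.
  rewrite integral_expR_abs ?divr_gt0 ?expR_gt0 //; congr (_%:E).
  by rewrite expRN; field; rewrite lt0r_neq0 ?expR_gt0.
have B0 t : 0 <= A t * (4 * expR (- t)) by rewrite mulr_ge0 // mulr_ge0 ?expR_ge0.
have mB : measurable_fun setT (fun z : T2 => A z.2 * (4 * expR (- z.2))).
  apply: measurable_funM => //; apply: measurable_funM => //.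
  by apply: measurable_fun_expR; exact: measurableT_comp.
rewrite lebesgue2_tonelli; last 2 first.
- exact/measurable_EFinP.
- by move=> z; rewrite lee_fin sqr_ge0.
apply: (@le_lt_trans _ _
   (\int[mu]_x \int[mu]_(t in `[0%R, +oo[) (A t * (4 * expR (- t)) * E x t)%:E)%E).
  apply: ge0_le_integral => //.
  - by move=> x _; apply: integral_ge0 => y _; rewrite lee_fin sqr_ge0.
  - have mK' : measurable_fun setT (fun z : T2 => (besselK nu (radius z) ^+ 2)%:E).
      exact/measurable_EFinP.
    by apply: (measurable_fun_fubini_tonelli_F _ mK') => z; rewrite lee_fin sqr_ge0.
  - apply: (@measurable_integral_snd _ _ _ _ _ mu _
      (fun z => A z.2 * (4 * expR (- z.2)) * E z.1 z.2)) => //.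
    + exact: measurable_funM.
    + by move=> z; rewrite mulr_ge0.
  move=> x _.
  have mH : measurable_fun setT (fun z : T2 => A z.2 * E x z.2 * E z.1 z.2).
    by apply: measurable_funM => //; exact: measurable_funM.
  have H0 z : 0 <= A z.2 * E x z.2 * E z.1 z.2 by rewrite mulr_ge0 // mulr_ge0.
  apply: (@le_trans _ _
    (\int[mu]_y \int[mu]_(t in `[0%R, +oo[) (A t * E x t * E y t)%:E)%E).
    apply: ge0_le_integral => //.
    - by move=> y _; rewrite lee_fin sqr_ge0.
    - by apply/measurable_EFinP; exact: (measurable_fun_pair2 x mK).
    - exact: (@measurable_integral_snd _ _ _ _ _ mu _
        (fun z => A z.2 * E x z.2 * E z.1 z.2) _ mH H0).
    - by move=> y _; exact: (besselK_sqr_le x y nu01).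
  rewrite (@tonelli_snd _ _ _ _ _ mu mu _
    (fun z => A z.2 * E x z.2 * E z.1 z.2)) //.
  rewrite le_eqVlt; apply/orP; left; apply/eqP; apply: eq_integral => t _ /=.
  have mEt := slice1 E t mE.
  rewrite (@integral_EFinZl _ _ _ mu _ _ (A t * E x t) (E^~ t)) //; last exact: mulr_ge0.
  by rewrite IE -EFinM mulrAC.
rewrite (@tonelli_snd _ _ _ _ _ mu mu _
    (fun z => A z.2 * (4 * expR (- z.2)) * E z.1 z.2)) //; last 2 first.
- exact: measurable_funM.
- by move=> z; rewrite mulr_ge0.
apply: (@le_lt_trans _ _
   (\int[mu]_(t in `[0%R, +oo[) (16 / a * expR (- a * t))%:E)%E); last first.
  rewrite integral_EFinZl ?divr_ge0 ?ltW //.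
  - by rewrite integral_expR_decay // -EFinM ltry.
  - by apply: measurable_fun_expR; exact: measurable_funM.
rewrite le_eqVlt; apply/orP; left; apply/eqP; apply: eq_integral => t _ /=.
have mEt := slice1 E t mE.
rewrite (@integral_EFinZl _ _ _ mu _ _ (A t * (4 * expR (- t))) (E^~ t)) //.
rewrite IE -EFinM; congr (_%:E); rewrite /A.
have -> : expR (- a * t) = expR ((1 + nu) * t) * expR (- t) * expR (- t).
  by rewrite -!expRD; congr expR; rewrite /a; ring.
by ring.
Qed.

End BesselL2.

(** * The wedge and polar coordinates *)

Section WedgeGeometry.
Variable R : realType.
Local Notation T2 := (measurableTypeR R * measurableTypeR R)%type.
Implicit Types (om r t : R) (z : R * R).

Lemma ratio_radius_itv z : -1 <= z.1 / radius z <= 1.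
Proof.
(* At the origin the quotient has the default value 0. *)
have [r0|r0] := eqVneq (radius z) 0.
  by rewrite r0 invr0 mulr0 oppr_le0 ler01.
have rp : 0 < radius z by rewrite lt0r r0 radius_ge0.
rewrite ler_pdivlMr // ler_pdivrMr // mulN1r mul1r -ler_norml.
exact: radius_ge1.
Qed.

Lemma acos_ratio_itv z : 0 <= acos (z.1 / radius z) <= pi.
Proof. by rewrite acos_ge0 ?acos_lepi // ratio_radius_itv. Qed.

Lemma norm_angle z : `|angle z| = acos (z.1 / radius z).
Proof.
have /andP[a0 _] := acos_ratio_itv z.
by rewrite /angle; case: ifP => _; rewrite ?normrN ger0_norm.
Qed.

Lemma cos_angle z : cos (angle z) = z.1 / radius z.
Proof.
by rewrite -cos_norm norm_angle acosK // in_itv /= ratio_radius_itv.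
Qed.

Lemma radius_polar r t : 0 <= r -> radius (r * cos t, r * sin t) = r.
Proof.
by move=> r0; rewrite /radius /= !exprMn -mulrDr cos2Dsin2 mulr1 sqrtr_sqr ger0_norm.
Qed.

Lemma radius_sqr z : radius z ^+ 2 = z.1 ^+ 2 + z.2 ^+ 2.
Proof. by rewrite sqr_sqrtr // addr_ge0 ?sqr_ge0. Qed.

Lemma sin_angle z : 0 < radius z -> sin (angle z) = z.2 / radius z.
Proof.
move=> r0.
have h : Num.sqrt (1 - (z.1 / radius z) ^+ 2) = `|z.2| / radius z.
  rewrite -[in RHS](ger0_norm (radius_ge0 z)) -normf_div -sqrtr_sqr; congr Num.sqrt.
  rewrite !exprMn exprVn radius_sqr; field.
  by rewrite -radius_sqr expf_neq0 // lt0r_neq0.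
rewrite /angle; case: ifP => z20.
  by rewrite sin_acos ?ratio_radius_itv // h ger0_norm.
rewrite sinN sin_acos ?ratio_radius_itv // h ltr0_norm ?mulNr ?opprK //.
by rewrite ltNge z20.
Qed.

(** As cos decreases on [0, pi], the condition |theta| < om reads cos om < cos theta; multiplying by
    r removes the angle. The strict inequality excludes the vertex. This form gives both the
    measurability of the wedge and the half-plane inside it. *)
Lemma wedgeE om : 0 < om -> om < pi ->
  wedge om = [set z | radius z * cos om < z.1].
Proof.
move=> om0 ompi; apply/seteqP; split => [_ [r [t [r0 tom ->]]]|z] /=.
  rewrite radius_polar ?ltW // ltr_pM2l // -(cos_norm t) ltr_cos ?in_itv /=.
  - exact: tom.
  - by rewrite normr_ge0 /= ltW // (lt_trans tom).
  - by rewrite !ltW.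
move=> zr.
have r0 : 0 < radius z.
  rewrite lt0r radius_ge0 andbT; apply/eqP => r0; move: zr.
  by have := radius_ge1 z; rewrite r0 mul0r normr_le0 => /eqP ->; rewrite ltxx.
exists (radius z), (angle z); split => //.
- have ai : acos (z.1 / radius z) \in `[0, pi] by rewrite in_itv /= acos_ratio_itv.
  have oi : om \in `[0, pi] by rewrite in_itv /= !ltW.
  have ri : z.1 / radius z \in `[-1, 1] by rewrite in_itv /= ratio_radius_itv.
  by rewrite norm_angle -(ltr_cos ai oi) (acosK ri) ltr_pdivlMr // mulrC.
- have e (a : R) : radius z * (a / radius z) = a.
    by rewrite mulrC divfK // lt0r_neq0.
  by rewrite cos_angle sin_angle // !e; case: z {zr r0 e}.
Qed.

Lemma measurable_wedge om : 0 < om -> om < pi ->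
  measurable (wedge om : set T2).
Proof.
move=> om0 ompi; rewrite wedgeE //.
have m1 : measurable_fun setT (fst : T2 -> R) by exact: measurable_fst.
have mr : measurable_fun setT (fun z : T2 => radius z * cos om).
  by apply: measurable_funM => //; exact: measurable_radius.
have := measurable_fun_ltr mr m1 measurableT (_ : measurable [set true]).
by rewrite setTI; apply.
Qed.

(** Beyond a right angle cos om <= 0, so the whole vertical line through any x > 0 stays in the
    wedge: increments along it never cross the boundary. *)
Lemma half_plane_wedge om (x y : R) : pi / 2 < om -> om < pi -> 0 < x ->
  wedge om (x, y).
Proof.
move=> om1 om2 x0; have om0 : 0 < om by apply: lt_trans om1; rewrite divr_gt0 ?pi_gt0.
rewrite wedgeE //=; apply: le_lt_trans x0.
rewrite mulr_ge0_le0 ?radius_ge0 //; apply: ltW.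
rewrite -cos_pihalf ltr_cos // in_itv /=.
- by rewrite divr_ge0 ?pi_ge0 //= ler_pdivrMr // ler_peMr ?pi_ge0 // ler1n.
- by rewrite !ltW.
Qed.

Lemma measurable_inv : measurable_fun setT (GRing.inv : R -> R).
Proof.
rewrite -(setvU [set 0]); apply/measurable_funU => //; first exact: measurableC.
split; last exact: measurable_fun_set1.
apply: open_continuous_measurable_fun.
  by apply/closed_openC/accessible_closed_set1/hausdorff_accessible/Rhausdorff.
by move=> x; rewrite inE /= => /eqP; exact: inv_continuous.
Qed.

(** Continuity gives the open interval; the endpoints are added as singletons, on which every
    function is measurable. *)
Lemma measurable_acos : measurable_fun (`[(-1 : R), 1]%classic : set (measurableTypeR R)) (@acos R).
Proof.
have -> : `[(-1 : R), 1]%classic = `](-1 : R), 1[%classic `|` ([set -1] `|` [set 1]).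
  apply/seteqP; split => x /=; rewrite !in_itv /=.
    move=> /andP[]; rewrite !le_eqVlt => /orP[/eqP <-|h1] /orP[/eqP ->|h2].
    - by right; left.
    - by right; left.
    - by right; right.
    - by left; rewrite h1.
  case=> [/andP[h1 h2]|[->|->]]; first by rewrite !ltW.
    by rewrite lexx /=; lra.
  by rewrite lexx andbT; lra.
apply/measurable_funU => //; first exact: measurableU.
split; last by apply/measurable_funU => //; split; exact: measurable_fun_set1.
apply: open_continuous_measurable_fun; first exact: interval_open.
by move=> x; rewrite inE /= in_itv /=; exact: continuous_acos.
Qed.

Lemma measurable_angle : measurable_fun setT (@angle R : T2 -> R).
Proof.
have m1 : measurable_fun setT (fst : T2 -> R) by exact: measurable_fst.
have m2 : measurable_fun setT (snd : T2 -> R) by exact: measurable_snd.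
have mq : measurable_fun setT (fun z : T2 => z.1 / radius z).
  have mi : measurable_fun setT (fun z : T2 => (radius z)^-1).
    exact: (measurableT_comp measurable_inv (@measurable_radius R)).
  exact: measurable_funM.
have ma : measurable_fun setT (fun z : T2 => acos (z.1 / radius z)).
  apply: (measurable_comp (F := `[(-1 : R), 1]%classic) _ _ measurable_acos mq) => //.
  by move=> _ [z _ <-] /=; rewrite in_itv /= ratio_radius_itv.
apply: measurable_fun_ifT => //; first exact: measurable_fun_ler.
exact: measurableT_comp.
Qed.

End WedgeGeometry.

(** * Square integrability of the singular fields *)

Section SpinorL2.
Context d (T : measurableType d) (R : realType).
Variables (mu : {measure set T -> \bar R}) (A : set T).
Implicit Types (f g : T -> R[i]) (u w : T -> spinor R) (c : R[i]).

Definition cmeasurable f := measurable_fun A (fun x => complex.Re (f x)) /\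
  measurable_fun A (fun x => complex.Im (f x)).

Definition field_measurable u := forall im i, measurable_fun A (rcoord im i u).

Lemma field_measurableP u :
  field_measurable u <-> cmeasurable (fun x => u x 0 0) /\ cmeasurable (fun x => u x 1 0).
Proof.
split=> [h|[[h0 h0'] [h1 h1']] im].
  by split; split; [exact: (h false 0)|exact: (h true 0)|exact: (h false 1)|
    exact: (h true 1)].
by elim/ord2P; case: im.
Qed.

Lemma cmeasurable_cst c : cmeasurable (fun=> c).
Proof. by split; exact: measurable_cst. Qed.

Lemma cmeasurable_real (h : T -> R) :
  measurable_fun A h -> cmeasurable (fun x => (h x)%:C%C).
Proof. by move=> mh; split => //=; exact: measurable_cst. Qed.

Lemma cmeasurableD f g :
  cmeasurable f -> cmeasurable g -> cmeasurable (fun x => f x + g x).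
Proof.
move=> [f1 f2] [g1 g2]; split.
  rewrite (_ : (fun x => _) = fun x => complex.Re (f x) + complex.Re (g x)).
    exact: measurable_funD.
  by apply/funext => x; case: (f x) (g x) => [a b] [? ?].
rewrite (_ : (fun x => _) = fun x => complex.Im (f x) + complex.Im (g x)).
  exact: measurable_funD.
by apply/funext => x; case: (f x) (g x) => [a b] [? ?].
Qed.

Lemma cmeasurableM f g :
  cmeasurable f -> cmeasurable g -> cmeasurable (fun x => f x * g x).
Proof.
move=> [f1 f2] [g1 g2]; split.
  rewrite (_ : (fun x => _) = fun x => complex.Re (f x) * complex.Re (g x)
      - complex.Im (f x) * complex.Im (g x)).
    by apply: measurable_funB; exact: measurable_funM.
  by apply/funext => x; case: (f x) (g x) => [a b] [? ?].
rewrite (_ : (fun x => _) = fun x => complex.Re (f x) * complex.Im (g x)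
    + complex.Im (f x) * complex.Re (g x)).
  by apply: measurable_funD; exact: measurable_funM.
by apply/funext => x; case: (f x) (g x) => [a b] [? ?].
Qed.

Lemma field_measurableZ f u : cmeasurable f -> field_measurable u ->
  field_measurable (fun x => f x *: u x).
Proof.
move=> mf /field_measurableP[u0 u1]; apply/field_measurableP.
by split; under eq_fun do rewrite entryE; exact: cmeasurableM.
Qed.

Lemma field_measurableD u w : field_measurable u -> field_measurable w ->
  field_measurable (fun x => u x + w x).
Proof.
move=> /field_measurableP[u0 u1] /field_measurableP[w0 w1]; apply/field_measurableP.
by split; under eq_fun do rewrite entryE; exact: cmeasurableD.
Qed.

Lemma field_measurableB u w : field_measurable u -> field_measurable w ->
  field_measurable (fun x => u x - w x).
Proof.
move=> mu_ mw; rewrite (_ : (fun x => _) = fun x => u x + (-1) *: w x).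
  by apply: field_measurableD => //; apply: field_measurableZ => //;
    exact: cmeasurable_cst.
by apply/funext => x; rewrite scaleN1r.
Qed.

Lemma measurable_normsq u : field_measurable u ->
  measurable_fun A (fun x => normsq (u x)).
Proof.
move=> mu_; under eq_fun do rewrite normsqE.
apply: measurable_funD; apply: measurable_funD; apply: measurable_funX.
- exact: (mu_ false 0).
- exact: (mu_ true 0).
- exact: (mu_ false 1).
- exact: (mu_ true 1).
Qed.

Lemma normsq_ge0 (z : spinor R) : 0 <= normsq z.
Proof. by rewrite normsqE !addr_ge0 ?sqr_ge0. Qed.

Lemma normsqD_le (z w : spinor R) : normsq (z + w) <= 2 * normsq z + 2 * normsq w.
Proof.
have h (a b : R) : (a + b) ^+ 2 <= 2 * a ^+ 2 + 2 * b ^+ 2.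
  have := sqr_ge0 (a - b); nra.
rewrite !normsqE !entryE.
case: (z 0 0) (z 1 0) (w 0 0) (w 1 0) => [a b] [a' b'] [e f] [e' f'] /=.
have := h a e; have := h a' e'; have := h b f; have := h b' f'; lra.
Qed.

Definition cnormsq c : R := complex.Re c ^+ 2 + complex.Im c ^+ 2.

Lemma normsqZ c (z : spinor R) : normsq (c *: z) = cnormsq c * normsq z.
Proof.
rewrite !normsqE !entryE /cnormsq.
case: c (z 0 0) (z 1 0) => [a b] [a' b'] [e f] /=; ring.
Qed.

Lemma normsqN (z : spinor R) : normsq (- z) = normsq z.
Proof.
by rewrite -scaleN1r normsqZ /cnormsq /= oppr0 sqrrN expr1n expr0n addr0 mul1r.
Qed.

Hypothesis mA : measurable A.

Lemma L2D u w : L2 mu A u -> L2 mu A w -> L2 mu A (fun x => u x + w x).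
Proof.
move=> [mu_ fu] [mw fw]; split; first exact: field_measurableD.
apply: (@le_lt_trans _ _
  (\int[mu]_(x in A) (2 * normsq (u x) + 2 * normsq (w x))%:E)%E).
  apply: integral_EFin_le => //.
  - exact: measurable_normsq (field_measurableD mu_ mw).
  - by apply: measurable_funD; apply: measurable_funM => //; exact: measurable_normsq.
  - by move=> x _; exact: normsq_ge0.
  - by move=> x _; exact: normsqD_le.
have n0 u' x : A x -> 0 <= normsq (u' x : spinor R) by move=> _; exact: normsq_ge0.
have mn2 u' : field_measurable u' -> measurable_fun A (fun x => 2 * normsq (u' x)).
  by move=> ?; apply: measurable_funM => //; exact: measurable_normsq.
rewrite integral_EFinD //; try exact: mn2;
  try (by move=> x _; rewrite mulr_ge0 ?normsq_ge0).
rewrite !integral_EFinZl //; try exact: measurable_normsq; try exact: n0.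
by apply: lte_add_pinfty; apply: lte_mul_pinfty.
Qed.

Lemma L2Z c u : L2 mu A u -> L2 mu A (fun x => c *: u x).
Proof.
move=> [mu_ fu]; split.
  by apply: field_measurableZ => //; exact: cmeasurable_cst.
under eq_integral do rewrite normsqZ.
rewrite integral_EFinZl //.
- by apply: lte_mul_pinfty => //; rewrite lee_fin addr_ge0 ?sqr_ge0.
- exact: measurable_normsq.
- by move=> x _; exact: normsq_ge0.
- by rewrite addr_ge0 ?sqr_ge0.
Qed.

Lemma L2B u w : L2 mu A u -> L2 mu A w -> L2 mu A (fun x => u x - w x).
Proof.
by move=> L2u L2w; apply: L2D => //; exact: L2_opp.
Qed.

Lemma L2_sigma3 u : L2 mu A u -> L2 mu A (fun x => sigma3 R *m u x).
Proof.
move=> [/field_measurableP[m0 m1] fu]; split.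
  apply/field_measurableP; rewrite /sigma3; split; under eq_fun do rewrite entryE.
    by apply: cmeasurableD; apply: cmeasurableM => //; exact: cmeasurable_cst.
  by apply: cmeasurableD; apply: cmeasurableM => //; exact: cmeasurable_cst.
rewrite (eq_integral (fun x => (normsq (u x))%:E)) // => x _; congr (_%:E).
rewrite !normsqE /sigma3 !entryE.
by case: (u x 0 0) (u x 1 0) => [a b] [a' b'] /=; ring.
Qed.

End SpinorL2.

Section SingularFields.
Variable R : realType.
Local Notation T2 := (measurableTypeR R * measurableTypeR R)%type.
Variable om : R.
Hypotheses (om1 : pi / 2 < om) (om2 : om < pi).

Let om0 : 0 < om.
Proof. by apply: lt_trans om1; rewrite divr_gt0 ?pi_gt0. Qed.

(** Together with [nu0_gt], this makes both orders nu0 and nu0 + 1 nonzero and of modulus less than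
    1: singular enough to leave H^1, yet square integrable. *)
Lemma nu0_lt0 : nu0 om < 0.
Proof.
rewrite /nu0 ltr_pdivrMr ?mul0r ?mulr_gt0 //.
have := om1; have := pi_gt0 R; lra.
Qed.

Lemma nu0_gt : - (1 / 2) < nu0 om.
Proof.
rewrite /nu0 ltr_pdivlMr ?mulr_gt0 //.
have := om1; have := pi_gt0 R; lra.
Qed.

(** v_+ and v_- are [sing0] minus or plus i times [sing1]. Each of these two fields has a norm that
    depends on the radius alone, and only one Bessel order. *)
Definition sing0 : spinor_field R := fun x =>
  (besselK (nu0 om) (radius x))%:C%C *: u0 om (angle x).

Definition sing1 : spinor_field R := fun x =>
  (besselK (nu0 om + 1) (radius x))%:C%C *: um1 om (angle x).

Lemma vplusE x : vplus om x = sing0 x - imag R *: sing1 x.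
Proof. by rewrite /vplus /sing0 /sing1 [in RHS]scalerA. Qed.

Lemma vminusE x : vminus om x = sing0 x + imag R *: sing1 x.
Proof. by rewrite /vminus /sing0 /sing1 [in RHS]scalerA. Qed.

Lemma cmeasurable_cis (h : T2 -> R) :
  measurable_fun setT h -> cmeasurable setT (fun x => cis (h x)).
Proof.
move=> mh; split => /=.
  by apply: measurableT_comp => //; apply: continuous_measurable_fun;
    exact: continuous_cos.
by apply: measurableT_comp => //; apply: continuous_measurable_fun;
    exact: continuous_sin.
Qed.

Lemma field_measurable_angular (k : R) (h1 h2 : T2 -> R) (a : R[i]) (g : T2 -> R) :
  measurable_fun setT h1 -> measurable_fun setT h2 -> measurable_fun setT g ->
  field_measurable setT (fun x => (g x)%:C%C *:
     (k%:C%C *: spinor2 (cis (h1 x)) (a * cis (h2 x)) : spinor R)).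
Proof.
move=> m1 m2 mg; apply: field_measurableZ; first exact: cmeasurable_real.
apply: field_measurableZ; first exact: cmeasurable_cst.
apply/field_measurableP; split; under eq_fun do rewrite entryE.
  exact: cmeasurable_cis.
by apply: cmeasurableM; [exact: cmeasurable_cst|exact: cmeasurable_cis].
Qed.

Let mK nu : measurable_fun setT (fun x : T2 => besselK nu (radius x)).
Proof. exact: (measurableT_comp (measurable_besselK nu) (@measurable_radius R)). Qed.

Let mangleM (c : R) : measurable_fun setT (fun x : T2 => angle x * c).
Proof. by apply: measurable_funM => //; exact: measurable_angle. Qed.

Lemma measurable_sing0 : field_measurable (T := T2) setT sing0.
Proof.
apply: field_measurable_angular; [exact: mangleM| |exact: mK].
exact: measurable_funN (mangleM _).
Qed.

Lemma measurable_sing1 : field_measurable (T := T2) setT sing1.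
Proof.
apply: field_measurable_angular; [|exact: mangleM|exact: mK].
exact: measurable_funN (mangleM _).
Qed.

Lemma cnormsq_cis (a : R) : cnormsq (cis a) = 1.
Proof. by rewrite /cnormsq /= cos2Dsin2. Qed.

Lemma normsq_angular (k : R) (a : R[i]) (s t : R) : cnormsq a = 1 ->
  normsq (k%:C%C *: spinor2 (cis s) (a * cis t) : spinor R) = 2 * k ^+ 2.
Proof.
move=> a1; rewrite normsqZ normsqE !entryE.
have -> : complex.Re (a * cis t) ^+ 2 + complex.Im (a * cis t) ^+ 2 =
    cnormsq a * cnormsq (cis t).
  by case: a {a1} => x y; rewrite /cnormsq /=; ring.
by rewrite -/(cnormsq (cis s)) a1 !cnormsq_cis /cnormsq /=; ring.
Qed.

(** The angular factor has constant squared norm 2 k^2, so the wedge can be enlarged to the plane,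
    where the integral of K_nu^2 is finite. *)
Lemma L2_singular nu (w : spinor_field R) (k : R) : `|nu| < 1 ->
  field_measurable (T := T2) setT w ->
  (forall x, normsq (w x) = besselK nu (radius x) ^+ 2 * (2 * k ^+ 2)) ->
  L2 (@lebesgue2 R) (wedge om) w.
Proof.
move=> nu1 mw wE; split; first by move=> im i; apply: measurable_funTS; exact: mw.
have mwedge := measurable_wedge om0 om2.
have mw2 := measurable_normsq mw.
apply: (@le_lt_trans _ _ (\int[@lebesgue2 R]_x (normsq (w x))%:E)%E).
  apply: ge0_subset_integral => //; first exact/measurable_EFinP.
  by move=> x _; rewrite lee_fin normsq_ge0.
under eq_integral do rewrite wE mulrC.
rewrite integral_EFinZl //; last 3 first.
- by apply: measurable_funTS; apply: measurable_funX; exact: mK.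
- by move=> x _; rewrite sqr_ge0.
- by rewrite mulr_ge0 ?sqr_ge0.
apply: lte_mul_pinfty => //; first by rewrite lee_fin mulr_ge0 ?sqr_ge0.
under eq_integral do rewrite besselK_norm.
by apply: integral_besselK_sqr; rewrite normr_ge0.
Qed.

Lemma L2_sing0 : L2 (@lebesgue2 R) (wedge om) sing0.
Proof.
apply: (@L2_singular (nu0 om) _ (1 / (2 * Num.sqrt om))).
- have := nu0_lt0; have := nu0_gt; rewrite ltr_norml; lra.
- exact: measurable_sing0.
- move=> x; rewrite normsqZ normsq_angular; last first.
    by rewrite /cnormsq /=; ring.
  by rewrite /cnormsq /= expr0n addr0.
Qed.

Lemma L2_sing1 : L2 (@lebesgue2 R) (wedge om) sing1.
Proof.
apply: (@L2_singular (nu0 om + 1) _ (1 / (2 * Num.sqrt om))).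
- have := nu0_lt0; have := nu0_gt; rewrite ltr_norml; lra.
- exact: measurable_sing1.
- move=> x; rewrite normsqZ normsq_angular; last first.
    by rewrite /cnormsq /=; ring.
  by rewrite /cnormsq /= expr0n addr0.
Qed.

Lemma L2_vplus : L2 (@lebesgue2 R) (wedge om) (vplus om).
Proof.
have mwedge := measurable_wedge om0 om2.
rewrite (_ : vplus om = fun x => sing0 x - imag R *: sing1 x).
  by apply: L2B => //; [exact: L2_sing0|apply: L2Z => //; exact: L2_sing1].
by apply/funext => x; exact: vplusE.
Qed.

Lemma L2_vminus : L2 (@lebesgue2 R) (wedge om) (vminus om).
Proof.
have mwedge := measurable_wedge om0 om2.
rewrite (_ : vminus om = fun x => sing0 x + imag R *: sing1 x).
  by apply: L2D => //; [exact: L2_sing0|apply: L2Z => //; exact: L2_sing1].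
by apply/funext => x; exact: vminusE.
Qed.

End SingularFields.

(** * Vertical increments of smooth fields *)

Section PlaneTools.
Variable R : realType.
Local Notation mu := (@lebesgue_measure R).
Local Notation T2 := (measurableTypeR R * measurableTypeR R)%type.

Lemma measurable_translation (t : R) :
  measurable_fun setT ((fun y => y + t) : measurableTypeR R -> measurableTypeR R).
Proof. by apply: measurable_funD. Qed.

(** The image measure agrees with Lebesgue measure on half-open intervals, which determine it. *)
Lemma lebesgue_measure_translation (t : R) (A : set (measurableTypeR R)) :
  measurable A ->
  pushforward mu ((fun y => y + t) : measurableTypeR R -> measurableTypeR R) A = mu A.
Proof.
pose phi : measurableTypeR R -> measurableTypeR R := fun y => y + t.
have mphi : measurable_fun setT phi by exact: measurable_translation.
pose phi_mixin := isMeasurableFun.Build _ _ _ _ phi mphi.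
pose phi_pack : {mfun measurableTypeR R >-> measurableTypeR R} := HB.pack phi phi_mixin.
move=> mA; apply/esym.
apply: (@lebesgue_measure_unique R (pushforward mu phi_pack)) => //= _ [[a b]] _ <-.
rewrite /pushforward /=.
have -> : phi @^-1` `]a, b]%classic = `](a - t), (b - t)]%classic.
  by apply/seteqP; split => y; rewrite /phi /= !in_itv /= ltrBlDr lerBrDr.
rewrite !lebesgue_measure_itv /= !lte_fin ltrD2r.
by rewrite -!EFinB opprB addrA subrK.
Qed.

Lemma integral_translation (h : R -> R) (t : R) :
  measurable_fun setT (h : measurableTypeR R -> R) -> (forall y, 0 <= h y) ->
  (\int[mu]_y (h (y + t))%:E = \int[mu]_y (h y)%:E)%E.
Proof.
move=> mh h0.
pose phi : measurableTypeR R -> measurableTypeR R := fun y => y + t.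
have mphi : measurable_fun setT phi by exact: measurable_translation.
transitivity (\int[pushforward mu phi]_y (h y)%:E)%E.
  rewrite ge0_integral_pushforward ?preimage_setT //; first exact/measurable_EFinP.
  by move=> y _; rewrite lee_fin.
apply: eq_measure_integral => A mA _; exact: lebesgue_measure_translation.
Qed.

Lemma integral_reflection (h : R -> R) :
  measurable_fun setT (h : measurableTypeR R -> R) -> (forall y, 0 <= h y) ->
  (\int[mu]_y (h (- y))%:E = \int[mu]_y (h y)%:E)%E.
Proof.
move=> mh h0.
pose phi : measurableTypeR R -> measurableTypeR R := -%R.
have mphi : measurable_fun setT phi by exact: measurable_funN (@measurable_id _ _ _).
transitivity (\int[pushforward mu phi]_y (h y)%:E)%E.
  rewrite ge0_integral_pushforward ?preimage_setT //; first exact/measurable_EFinP.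
  by move=> y _; rewrite lee_fin.
by apply: eq_measure_integral => A mA _; exact: lebesgue_measureN.
Qed.

(** The sigma-algebra here is the product one, so each open set f > a is written as a countable
    union of boxes with rational endpoints. *)
Lemma continuous_measurable2 (f : R * R -> R) :
  continuous f -> measurable_fun setT (f : T2 -> R).
Proof.
move=> cf; apply: (measurability _ (RGenOInfty.measurableE R)) => //.
move=> /= _ [_ [a ->] <-]; rewrite setTI preimage_itvoy.
pose box (p q r s : rat) : set T2 :=
  `]ratr p, ratr q[%classic `*` `]ratr r, ratr s[%classic.
(* Boxes that are not contained in the set are replaced by the empty set, so that the unions range
   over all rationals. *)
rewrite [X in measurable X](_ : _ = \bigcup_(p : rat) \bigcup_(q : rat)
  \bigcup_(r : rat) \bigcup_(s : rat)
    (if `[< box p q r s `<=` [set z | a < f z] >] then box p q r s else set0)).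
  do 4 (apply: bigcupT_measurable_rat => ?).
  by case: ifP => // _; apply: measurableX.
apply/seteqP; split => [[x y] /= afz|z [p _] [q _] [r _] [s _]]; last first.
  by case: asboolP => // h /h.
have : nbhs (x, y) [set z | a < f z].
  have : nbhs (f (x, y)) [set r | a < r].
    by apply: open_nbhs_nbhs; split => //=; exact: open_gt.
  exact: cf.
move=> /nbhs_ballP[e /= e0 he].
have xe : x - e < x by rewrite ltrBlDr ltrDl.
have xe' : x < x + e by rewrite ltrDl.
have ye : y - e < y by rewrite ltrBlDr ltrDl.
have ye' : y < y + e by rewrite ltrDl.
have [p] := rat_in_itvoo xe; rewrite in_itv /= => /andP[p1 p2].
have [q] := rat_in_itvoo xe'; rewrite in_itv /= => /andP[q1 q2].
have [r] := rat_in_itvoo ye; rewrite in_itv /= => /andP[r1 r2].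
have [s] := rat_in_itvoo ye'; rewrite in_itv /= => /andP[s1 s2].
exists p => //; exists q => //; exists r => //; exists s => //.
case: asboolP => [_|]; first by split; rewrite /= in_itv /= ?p2 ?r2.
case=> -[x' y'] [/=]; rewrite !in_itv /= => /andP[? ?] /andP[? ?].
apply: he; split; rewrite /ball /= ltr_norml; apply/andP; split; lra.
Qed.

(** The fundamental theorem of calculus followed by Cauchy-Schwarz on [a, b]. *)
Lemma sqr_increment_le (g g' : R -> R) (a b : R) : a < b ->
  (forall x : R, is_derive x (1 : R) g (g' x)) -> continuous g' ->
  (((g b - g a) ^+ 2)%:E <=
     (b - a)%:E * \int[mu]_(s in `[a, b]) ((g' s) ^+ 2)%:E)%E.
Proof.
move=> ab dg cg'.
have mab : measurable (`[a, b]%classic : set (measurableTypeR R)) by [].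
have ba0 : 0 < b - a by rewrite subr_gt0.
have mg' : measurable_fun setT (g' : measurableTypeR R -> R).
  exact: continuous_measurable_fun.
have cg x : {for x, continuous g}.
  by apply: differentiable_continuous; apply/derivable1_diffP; apply: ex_derive.
have ftc : (\int[mu]_(x in `[a, b]) (g' x)%:E = (g b)%:E - (g a)%:E)%E.
  apply: continuous_FTC2 => //.
  - exact: continuous_subspaceT.
  - split => //.
    + by apply: cvg_at_right_filter; exact: cg.
    + by apply: cvg_at_left_filter; exact: cg.
  - by move=> x _; rewrite derive1E; apply: derive_val.
have Ig : mu.-integrable `[a, b] (EFin \o g').
  by apply: continuous_compact_integrable; [exact: segment_compact|exact: continuous_subspaceT].
have mag : measurable_fun `[a, b] (fun x => `|g' x|).
  by apply: measurable_funTS; exact: measurableT_comp.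
have h : `|g b - g a| <= Rintegral mu `[a, b] (fun x => `|g' x|).
  have -> : g b - g a = Rintegral mu `[a, b] g' by rewrite /Rintegral ftc.
  exact: le_normr_Rintegral.
apply: (@le_trans _ _ (((Rintegral mu `[a, b] (fun x => `|g' x|)) ^+ 2)%:E)).
  by rewrite lee_fin -(real_normK (num_real (g b - g a))) ler_pXn2r // nnegrE
    (le_trans _ h).
(* Constant weights: p is the uniform density on [a, b] and q = b - a. The absolute value meets the
   positivity hypothesis on f. *)
have := @sqr_Rintegral_le _ _ _ mu _ mab (fun x => `|g' x|)
  (cst ((b - a)^-1)) (cst (b - a)) mag.
move=> /(_ (measurable_cst _) (measurable_cst _)).
have -> : (\int[mu]_(x in `[a, b]) (cst ((b - a)^-1) x)%:E)%E = 1%E.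
  rewrite (eq_integral (cst ((b - a)^-1)%:E)) // integral_cst //=.
  rewrite lebesgue_measure_itv /= lte_fin ab -EFinB -EFinM.
  by rewrite mulVf ?lt0r_neq0.
move=> H; apply: le_trans (H _ _ _ (lexx _)) _.
- by move=> x _; exact: normr_ge0.
- by move=> x _; rewrite /= invr_gt0.
- by move=> x _; rewrite /= mulVf ?lt0r_neq0.
rewrite -integral_EFinZl //; last 3 first.
- by apply: measurable_funX; exact: measurable_funTS.
- by move=> x _; exact: sqr_ge0.
- exact: ltW.
rewrite le_eqVlt; apply/orP; left; apply/eqP; apply: eq_integral => x _ /=.
by rewrite real_normK ?num_real // mulrC.
Qed.

End PlaneTools.

Section VerticalEstimate.
Variable R : realType.
Local Notation mu := (@lebesgue_measure R).
Local Notation T2 := (measurableTypeR R * measurableTypeR R)%type.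

Lemma is_derive_slice (f : R * R -> R) (x y : R) : derivable f (x, y) (e2 R) ->
  is_derive y (1 : R) (fun s => f (x, s)) ('D_(e2 R) f (x, y)).
Proof.
have E : (fun h : R => h^-1 *: (((fun s => f (x, s)) \o shift y) (h *: (1 : R)) - f (x, y))) =
   (fun h : R => h^-1 *: ((f \o shift (x, y)) (h *: e2 R) - f (x, y))).
  apply/funext => h; congr (_ *: (f _ - _)).
  by rewrite /shift /= /e2; congr pair; rewrite /= scaler0 add0r.
move=> df; apply: DeriveDef; first by rewrite /derivable E.
by rewrite /derive E.
Qed.

Section SmoothField.
Variables (u : spinor_field R) (su : smooth_field u).

Lemma smooth_field_continuous im i : continuous (rcoord im i u).
Proof.
by move=> z; apply: differentiable_continuous; have [sf _ _] := su im i; exact: (sf [::]).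
Qed.

Lemma deriv_field_continuous v im i : continuous (rcoord im i (deriv_field v u)).
Proof.
move=> z; rewrite rcoord_deriv_field; apply: differentiable_continuous.
by have [sf _ _] := su im i; exact: (sf [:: v]).
Qed.

Lemma field_measurable_smooth : field_measurable (T := T2) setT u.
Proof. by move=> im i; apply: continuous_measurable2; exact: smooth_field_continuous. Qed.

Lemma field_measurable_deriv v : field_measurable (T := T2) setT (deriv_field v u).
Proof. by move=> im i; apply: continuous_measurable2; exact: deriv_field_continuous. Qed.

Lemma normsq_rcoord (T : Type) (w : T -> spinor R) t : normsq (w t) =
  rcoord false 0 w t ^+ 2 + rcoord true 0 w t ^+ 2
  + (rcoord false 1 w t ^+ 2 + rcoord true 1 w t ^+ 2).
Proof. exact: normsqE. Qed.

(** Sum of the one-dimensional bound over the four real coordinates. The integral is enlarged to the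
    full vertical line, so that for a given length b - a the bound does not depend on a. *)
Lemma normsq_increment_le (x a b : R) : a < b ->
  ((normsq (u (x, b) - u (x, a)))%:E <=
   (b - a)%:E * \int[mu]_s (normsq (deriv_field (e2 R) u (x, s)))%:E)%E.
Proof.
move=> ab; have ba0 : 0 <= b - a by rewrite subr_ge0 ltW.
pose g im i s := rcoord im i (deriv_field (e2 R) u) (x, s).
have cslice : continuous (fun s : R => (x, s)).
  move=> s; apply: differentiable_continuous; apply: differentiable_pair.
    exact: differentiable_cst.
  exact: ex_diff.
have cg im i : continuous (g im i).
  move=> s; apply: (@continuous_comp _ _ _ (fun s : R => (x, s))).
    exact: cslice.
  exact: deriv_field_continuous.
have mg2 im i : measurable_fun setT (fun s : measurableTypeR R => g im i s ^+ 2).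
  by apply: measurable_funX; apply: continuous_measurable_fun; exact: cg.
have step im i : (((rcoord im i u (x, b) - rcoord im i u (x, a)) ^+ 2)%:E <=
    (b - a)%:E * \int[mu]_s (g im i s ^+ 2)%:E)%E.
  have dg s : is_derive s (1 : R) (fun s => rcoord im i u (x, s)) (g im i s).
    rewrite /g rcoord_deriv_field; apply: is_derive_slice.
    exact: smooth_field_derivable.
  apply: le_trans (sqr_increment_le ab dg (cg im i)) _.
  apply: lee_wpmul2l; first by rewrite lee_fin.
  apply: ge0_subset_integral => //; first exact/measurable_EFinP.
  by move=> s _; rewrite lee_fin sqr_ge0.
have -> : normsq (u (x, b) - u (x, a)) =
  (rcoord false 0 u (x, b) - rcoord false 0 u (x, a)) ^+ 2
  + (rcoord true 0 u (x, b) - rcoord true 0 u (x, a)) ^+ 2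
  + ((rcoord false 1 u (x, b) - rcoord false 1 u (x, a)) ^+ 2
  + (rcoord true 1 u (x, b) - rcoord true 1 u (x, a)) ^+ 2).
  rewrite normsqE !entryE /rcoord.
  by case: (u (x, b) 0 0) (u (x, b) 1 0) (u (x, a) 0 0) (u (x, a) 1 0)
    => [? ?] [? ?] [? ?] [? ?].
under eq_integral do rewrite normsq_rcoord.
have g0 im i s : 0 <= g im i s ^+ 2 by exact: sqr_ge0.
rewrite (@integral_EFinD _ _ _ mu _ _ (fun s => g false 0 s ^+ 2 + g true 0 s ^+ 2)
  (fun s => g false 1 s ^+ 2 + g true 1 s ^+ 2)) //; last 4 first.
- exact: measurable_funD.
- exact: measurable_funD.
- by move=> s _; rewrite addr_ge0.
- by move=> s _; rewrite addr_ge0.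
rewrite (@integral_EFinD _ _ _ mu _ _ (fun s => g false 0 s ^+ 2)
  (fun s => g true 0 s ^+ 2)) //.
rewrite (@integral_EFinD _ _ _ mu _ _ (fun s => g false 1 s ^+ 2)
  (fun s => g true 1 s ^+ 2)) //.
have I0 im i : (0 <= \int[mu]_s (g im i s ^+ 2)%:E)%E by exact: integral_EFin_ge0.
move: (I0 false 0) (I0 true 0) (I0 false 1) (I0 true 1)
  (step false 0) (step true 0) (step false 1) (step true 1).
move: (\int[mu]_s (g false 0 s ^+ 2)%:E)%E (\int[mu]_s (g true 0 s ^+ 2)%:E)%E
  (\int[mu]_s (g false 1 s ^+ 2)%:E)%E (\int[mu]_s (g true 1 s ^+ 2)%:E)%E.
move=> I1 I2 I3 I4 p1 p2 p3 p4 s1 s2 s3 s4.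
rewrite !EFinD ge0_muleDr ?adde_ge0 // (ge0_muleDr _ p1) // (ge0_muleDr _ p3) //.
by apply: leeD; apply: leeD.
Qed.

End SmoothField.

(** From p - q = (p - p') - (q - q') + (p' - q') and the square of a sum of three terms: it trades
    an increment of W for one of a smooth u at the cost of two pointwise errors. *)
Lemma normsq_increment_split (p q p' q' : spinor R) :
  normsq (p - q) <= 3 * normsq (p - p') + 3 * normsq (q - q') + 3 * normsq (p' - q').
Proof.
have h (a b c d : R) : (a - b) ^+ 2 <=
    3 * (a - c) ^+ 2 + 3 * (b - d) ^+ 2 + 3 * (c - d) ^+ 2.
  have -> : a - b = (a - c) - (b - d) + (c - d) by ring.
  move: (a - c) (b - d) (c - d) => s t r.
  have := sqr_ge0 (s + t); have := sqr_ge0 (s - r); have := sqr_ge0 (t + r); nra.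
rewrite !normsqE !entryE.
case: (p 0 0) (p 1 0) (q 0 0) (q 1 0) (p' 0 0) (p' 1 0) (q' 0 0) (q' 1 0)
  => [a1 a2] [a3 a4] [b1 b2] [b3 b4] [c1 c2] [c3 c4] [d1 d2] [d3 d4] /=.
have := h a1 b1 c1 d1; have := h a2 b2 c2 d2; have := h a3 b3 c3 d3.
have := h a4 b4 c4 d4; lra.
Qed.

Lemma integral_EFinD4 d (T : measurableType d) (nu : {measure set T -> \bar R})
    (D : set T) (f1 f2 f3 f4 f5 : T -> R) : measurable D ->
  measurable_fun D f1 -> measurable_fun D f2 -> measurable_fun D f3 ->
  measurable_fun D f4 -> measurable_fun D f5 ->
  (forall x, 0 <= f1 x) -> (forall x, 0 <= f2 x) -> (forall x, 0 <= f3 x) ->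
  (forall x, 0 <= f4 x) -> (forall x, 0 <= f5 x) ->
  (\int[nu]_(x in D) (f1 x + f2 x + (f3 x + f4 x) + f5 x)%:E =
   \int[nu]_(x in D) (f1 x)%:E + \int[nu]_(x in D) (f2 x)%:E
   + (\int[nu]_(x in D) (f3 x)%:E + \int[nu]_(x in D) (f4 x)%:E)
   + \int[nu]_(x in D) (f5 x)%:E)%E.
Proof.
move=> mD m1 m2 m3 m4 m5 p1 p2 p3 p4 p5.
have m12 := measurable_funD m1 m2; have m34 := measurable_funD m3 m4.
have p12 x : 0 <= f1 x + f2 x by rewrite addr_ge0.
have p34 x : 0 <= f3 x + f4 x by rewrite addr_ge0.
rewrite (integral_EFinD nu mD (measurable_funD m12 m34) m5
  (fun x _ => addr_ge0 (p12 x) (p34 x)) (fun x _ => p5 x)).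
rewrite (integral_EFinD nu mD m12 m34 (fun x _ => p12 x) (fun x _ => p34 x)).
rewrite (integral_EFinD nu mD m1 m2 (fun x _ => p1 x) (fun x _ => p2 x)).
by rewrite (integral_EFinD nu mD m3 m4 (fun x _ => p3 x) (fun x _ => p4 x)).
Qed.

Lemma muleE12 (I : \bar R) : (0 <= I)%E ->
  (12%:E * I = 3%:E * I + 3%:E * I + (3%:E * I + 3%:E * I))%E.
Proof.
move=> I0; rewrite -!ge0_muleDl ?lee_fin // -!EFinD.
by congr (_%:E * _)%E; ring.
Qed.

(** Increments at y and at its mirror image are added because [singular_decoupling] combines a
    component at (x, y) with one at (x, - y) to separate the two singular fields. *)
Definition vertical_gap (W : spinor_field R) (e x y : R) : R :=
  normsq (W (x, y) - W (x, y + 3 * e)) + normsq (W (x, - y) - W (x, - (y + 3 * e))).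

(** The pointwise bound is integrated over 0 <= y <= e. The error W - u occurs at four heights with
    factor 3; translations and reflections preserve the integral over the line, whence 12. Two
    increments of u, each at most 3 e G, with factor 3 and over a length e, give 18 e^2 G. *)
Lemma vertical_gap_le (W u : spinor_field R) (e x c : R) : 0 < e ->
  field_measurable (T := T2) setT W -> smooth_field u ->
  (forall y, 0 <= y <= e -> c <= vertical_gap W e x y) ->
  ((c * e)%:E <= 12%:E * \int[mu]_s (normsq (W (x, s) - u (x, s)))%:E
     + (18 * e ^+ 2)%:E * \int[mu]_s (normsq (deriv_field (e2 R) u (x, s)))%:E)%E.
Proof.
move=> e0 mW su gap.
pose E s := normsq (W (x, s) - u (x, s)).
have E0 s : 0 <= E s by exact: normsq_ge0.
have mE : measurable_fun setT (E : measurableTypeR R -> R).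
  have := measurable_normsq (field_measurableB mW (field_measurable_smooth su)).
  exact: (measurable_fun_pair2 x).
have IE0 : (0 <= \int[mu]_s (E s)%:E)%E by exact: integral_EFin_ge0.
have : (0 <= \int[mu]_s (normsq (deriv_field (e2 R) u (x, s)))%:E)%E.
  by apply: integral_EFin_ge0 => s _; exact: normsq_ge0.
rewrite -/(E _).
(* Only a finite G needs work: if it is infinite, so is the right-hand side. *)
have := normsq_increment_le su x.
case: (\int[mu]_s (normsq (deriv_field (e2 R) u (x, s)))%:E)%E => [G| |] //= inc G0;
  last first.
  rewrite gt0_muley ?addey ?leey //.
    by rewrite -ltNye (lt_le_trans ltNy0) // mule_ge0.
  by rewrite lte_fin mulr_gt0 // exprn_gt0.
rewrite lee_fin in G0.
have incr a : normsq (u (x, a) - u (x, a + 3 * e)) <= 3 * e * G.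
  have a3 : a < a + 3 * e by rewrite ltrDl mulr_gt0.
  have := inc a (a + 3 * e) a3.
  by rewrite -EFinM lee_fin addrAC subrr add0r -normsqN opprB.
have pt y : 0 <= y <= e -> c <= 3 * E y + 3 * E (y + 3 * e)
    + (3 * E (- y) + 3 * E (- (y + 3 * e))) + 18 * e * G.
  move=> /gap /le_trans; apply; rewrite /vertical_gap.
  have h1 := normsq_increment_split (W (x, y)) (W (x, y + 3 * e))
    (u (x, y)) (u (x, y + 3 * e)).
  have h2 := normsq_increment_split (W (x, - y)) (W (x, - (y + 3 * e)))
    (u (x, - y)) (u (x, - (y + 3 * e))).
  have h3 := incr y; have h4 := incr (- (y + 3 * e)).
  (* The lower increment is read upwards, starting from - (y + 3 e). *)
  have e4 : - (y + 3 * e) + 3 * e = - y by ring.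
  rewrite e4 -normsqN opprB in h4.
  by move: h1 h2 h3 h4; rewrite -!/(E _); lra.
have mt t : measurable_fun setT (fun y : measurableTypeR R => E (y + t)).
  by apply: (measurableT_comp mE); exact: measurable_translation.
have mn : measurable_fun setT (fun y : measurableTypeR R => E (- y)).
  by apply: (measurableT_comp mE); exact: measurable_funN (@measurable_id _ _ _).
have mnt t : measurable_fun setT (fun y : measurableTypeR R => E (- (y + t))).
  by apply: (measurableT_comp mn); exact: measurable_translation.
have sub (h : R -> R) : measurable_fun setT (h : measurableTypeR R -> R) ->
    (forall y, 0 <= h y) -> (\int[mu]_y (h y)%:E = \int[mu]_y (E y)%:E)%E ->
    (\int[mu]_(y in `[0%R, e]) (3 * h y)%:E <= 3%:E * \int[mu]_y (E y)%:E)%E.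
  move=> mh h0 hE; rewrite integral_EFinZl //; last exact: measurable_funTS.
  apply: lee_wpmul2l; first by rewrite lee_fin.
  rewrite -hE; apply: ge0_subset_integral => //; first exact/measurable_EFinP.
  by move=> y _; rewrite lee_fin.
have sub1 := sub E mE E0 erefl.
have sub2 := sub _ (mt (3 * e)) (fun=> E0 _) (integral_translation (3 * e) mE E0).
have sub3 := sub _ mn (fun=> E0 _) (integral_reflection mE E0).
have refl := integral_reflection mE E0.
have sub4 := sub _ (mnt (3 * e)) (fun=> E0 _)
   (etrans (integral_translation (3 * e) mn (fun=> E0 _)) refl).
have mitv : measurable (`[0%R, e]%classic : set (measurableTypeR R)) by [].
have len : mu `[0%R, e] = e%:E.
  by rewrite lebesgue_measure_itv /= lte_fin e0 -EFinB subr0.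
have IS r : (\int[mu]_(y in `[0%R, e]) r%:E = (r * e)%:E)%E.
  have := integral_cst mu mitv r%:E; rewrite /= => ->.
  by rewrite EFinM; congr (_ * _)%E; exact: len.
have m3 (h : R -> R) : measurable_fun setT (h : measurableTypeR R -> R) ->
    measurable_fun `[0%R, e] (fun y : measurableTypeR R => 3 * h y).
  by move=> mh; apply: measurable_funTS; exact: measurable_funM.
have m31 := m3 _ mE; have m32 := m3 _ (mt (3 * e)).
have m33 := m3 _ mn; have m34 := m3 _ (mnt (3 * e)).
(* Comparison of integrals asks for a nonnegative integrand; a negative c makes the claim
   trivial. *)
have [cn|cp] := ltP c 0.
  apply: (@le_trans _ _ 0%E); first by rewrite lee_fin mulr_le0_ge0 ?ltW.
  apply: adde_ge0; first by apply: mule_ge0.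
  by rewrite lee_fin; exact (mulr_ge0 (mulr_ge0 (ler0n _ 18) (sqr_ge0 e)) G0).
rewrite -IS.
have p3 y : 0 <= 3 * E y by apply: mulr_ge0; first exact: ler0n.
have pG : 0 <= 18 * e * G by exact (mulr_ge0 (mulr_ge0 (ler0n _ 18) (ltW e0)) G0).
have mG : measurable_fun `[0%R, e] (fun=> 18 * e * G : R) by exact: measurable_cst.
have S4 := integral_EFinD4 mu mitv m31 m32 m33 m34 mG p3 (fun=> p3 _) (fun=> p3 _)
  (fun=> p3 _) (fun=> pG).
apply: (@le_trans _ _ (\int[mu]_(y in `[0%R, e])
   (3 * E y + 3 * E (y + 3 * e) + (3 * E (- y) + 3 * E (- (y + 3 * e)))
     + 18 * e * G)%:E)%E).
  apply: integral_EFin_le; [exact: mitv|exact: measurable_cst| | |].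
  - exact (measurable_funD (measurable_funD (measurable_funD m31 m32)
      (measurable_funD m33 m34)) mG).
  - by move=> y _.
  - exact: pt.
rewrite S4 IS -EFinM; apply: leeD; last first.
  by rewrite lee_fin le_eqVlt; apply/orP; left; apply/eqP; ring.
move: (\int[mu]_s (E s)%:E)%E IE0 sub1 sub2 sub3 sub4 => I I0 s1 s2 s3 s4.
rewrite (muleE12 I0); exact: leeD (leeD s1 s2) (leeD s3 s4).
Qed.

End VerticalEstimate.

(** * The increment bound for limits in H^1 *)

Section H1Bound.
Variable R : realType.
Local Notation mu := (@lebesgue_measure R).
Local Notation T2 := (measurableTypeR R * measurableTypeR R)%type.
Variable om : R.
Hypotheses (om1 : pi / 2 < om) (om2 : om < pi).

Let mwedge : measurable (wedge om : set T2).
Proof.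
by apply: measurable_wedge => //; apply: lt_trans om1; rewrite divr_gt0 ?pi_gt0.
Qed.

(** Tonelli: over x >= a > 0 the vertical sections of the wedge are full lines. *)
Lemma strip_integral_le (F : T2 -> R) (a b : R) : 0 < a ->
  measurable_fun setT F -> (forall z, 0 <= F z) ->
  (\int[mu]_(x in `[a, b]) \int[mu]_s (F (x, s))%:E <=
   \int[@lebesgue2 R]_(z in wedge om) (F z)%:E)%E.
Proof.
move=> a0 mF F0.
pose FW z := (F z * \1_(wedge om : set T2) z)%:E.
have m1W : measurable_fun setT (\1_(wedge om : set T2) : T2 -> R).
  exact: measurable_indic.
have mFW : measurable_fun setT FW.
  by apply/measurable_EFinP; exact: measurable_funM.
have FW0 z : (0 <= FW z)%E by rewrite lee_fin mulr_ge0.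
have -> : (\int[@lebesgue2 R]_(z in wedge om) (F z)%:E =
    \int[mu]_x \int[mu]_s FW (x, s))%E.
  rewrite integral_mkcond -lebesgue2_tonelli //; apply: eq_integral => z _.
  by rewrite patchE /FW indicE; case: ifP => _; rewrite ?mulr1 ?mulr0.
have mI := measurable_fun_fubini_tonelli_F (m2 := mu) FW mFW FW0.
have I0 x : (0 <= \int[mu]_s FW (x, s))%E by apply: integral_ge0.
apply: (@le_trans _ _ (\int[mu]_(x in `[a, b]) \int[mu]_s FW (x, s))%E).
  rewrite le_eqVlt; apply/orP; left; apply/eqP; apply: eq_integral => x.
  rewrite inE /= in_itv /= => /andP[ax _]; apply: eq_integral => s _.
  by rewrite /FW indicE mem_set ?mulr1 //; apply: half_plane_wedge => //; exact: lt_le_trans ax.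
by apply: ge0_subset_integral.
Qed.

Lemma gap_energy_le (W u : spinor_field R) (e c : R) : 0 < e -> 0 <= c ->
  field_measurable (T := T2) setT W -> smooth_field u ->
  (forall x y, e <= x <= 2 * e -> 0 <= y <= e -> c <= vertical_gap W e x y) ->
  ((c * e ^+ 2)%:E <=
   12%:E * \int[@lebesgue2 R]_(z in wedge om) (normsq (W z - u z))%:E
   + (18 * e ^+ 2)%:E *
     \int[@lebesgue2 R]_(z in wedge om) (normsq (deriv_field (e2 R) u z))%:E)%E.
Proof.
move=> e0 c0 mW su gap.
pose A (z : T2) := normsq (W z - u z).
pose B (z : T2) := normsq (deriv_field (e2 R) u z).
have A0 z : 0 <= A z by exact: normsq_ge0.
have B0 z : 0 <= B z by exact: normsq_ge0.
have mA : measurable_fun setT A.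
  exact: (measurable_normsq (field_measurableB mW (field_measurable_smooth su))).
have mB : measurable_fun setT B.
  exact: (measurable_normsq (field_measurable_deriv su (e2 R))).
have IA := strip_integral_le (2 * e) e0 mA A0.
have IB := strip_integral_le (2 * e) e0 mB B0.
have mitv : measurable (`[e, (2 * e)]%classic : set (measurableTypeR R)) by [].
pose SA x := (\int[mu]_s (A (x, s))%:E)%E.
pose SB x := (\int[mu]_s (B (x, s))%:E)%E.
have SA0 x : (0 <= SA x)%E by exact: integral_EFin_ge0.
have SB0 x : (0 <= SB x)%E by exact: integral_EFin_ge0.
have mSA : measurable_fun setT (SA : measurableTypeR R -> _).
  apply: (measurable_fun_fubini_tonelli_F (fun z => (A z)%:E)) => //.
  exact/measurable_EFinP.
have mSB : measurable_fun setT (SB : measurableTypeR R -> _).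
  apply: (measurable_fun_fubini_tonelli_F (fun z => (B z)%:E)) => //.
  exact/measurable_EFinP.
have k0 : 0 <= 18 * e ^+ 2 by exact: mulr_ge0 (ler0n _ 18) (sqr_ge0 e).
have ce : (\int[mu]_(x in `[e, (2 * e)%R]) (c * e)%:E = (c * e ^+ 2)%:E)%E.
  have := integral_cst mu mitv (c * e)%:E; rewrite /= => ->.
  transitivity ((c * e)%:E * e%:E)%E; last by rewrite -EFinM; congr (_%:E); ring.
  congr (_ * _)%E; rewrite [LHS]lebesgue_measure_itv /= lte_fin.
  rewrite ltr_pMl // ltr1n -EFinB; congr (_%:E); ring.
rewrite -ce.
apply: (@le_trans _ _
  (\int[mu]_(x in `[e, (2 * e)%R]) (12%:E * SA x + (18 * e ^+ 2)%:E * SB x))%E).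
  apply: ge0_le_integral => //.
  - by move=> x _; rewrite lee_fin mulr_ge0 // ltW.
  - by apply: emeasurable_funD; apply: measurable_funeM; exact: measurable_funTS.
  move=> x; rewrite /= in_itv /= => xe.
  by apply: vertical_gap_le => // y ye; exact: gap.
have mSA' := measurable_funTS mSA : measurable_fun `[e, (2 * e)%R] SA.
have mSB' := measurable_funTS mSB : measurable_fun `[e, (2 * e)%R] SB.
have p12 : 0 <= 12 :> R by exact: ler0n.
rewrite ge0_integralD //; last 4 first.
- by move=> x _; apply: mule_ge0; rewrite ?lee_fin.
- exact: measurable_funeM.
- by move=> x _; apply: mule_ge0; rewrite ?lee_fin.
- exact: measurable_funeM.
rewrite ge0_integralZl_EFin // ge0_integralZl_EFin //.
by apply: leeD; apply: lee_wpmul2l; rewrite ?lee_fin.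
Qed.

Lemma cvg0_lt (d : nat -> \bar R) (t : R) : 0 < t ->
  d @ \oo --> 0%E -> \forall n \near \oo, (d n < t%:E)%E.
Proof.
move=> t0 d0.
have : nbhs (0%E : \bar R) [set x | (x < t%:E)%E].
  by apply: open_nbhs_nbhs; split; [exact: open_ereal_lt_ereal|rewrite /= lte_fin].
exact: d0.
Qed.

(** At fixed e the error term vanishes along the approximating sequence. The derivative term is at
    most 18 e^2 times 2 G plus a vanishing error, where G is the squared norm of the vertical
    derivative [g2]. Dividing by e^2 leaves c <= 36 G, with no e. *)
Lemma vertical_gap_bound (v W : spinor_field R) t : is_trace om v t ->
  field_measurable (T := T2) setT W ->
  ae_eq (@lebesgue2 R) (wedge om) v W ->
  exists M : R, forall e c : R, 0 < e -> 0 <= c ->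
    (forall x y, e <= x <= 2 * e -> 0 <= y <= e -> c <= vertical_gap W e x y) ->
    c <= M.
Proof.
move=> [phi [g1 [g2 [sphi [L2v L2g1 L2g2 _ _] [cv _ cg2] _]]]] mW vW.
have [mv _] := L2v; have [mg2 fg2] := L2g2.
have G0 : (0 <= \int[@lebesgue2 R]_(z in wedge om) (normsq (g2 z))%:E)%E.
  by apply: integral_EFin_ge0 => z _; exact: normsq_ge0.
exists (36 * fine (\int[@lebesgue2 R]_(z in wedge om) (normsq (g2 z))%:E)%E).
move=> e c e0 c0 gap.
move: fg2 G0; set G := (\int[@lebesgue2 R]_(z in wedge om) (normsq (g2 z))%:E)%E => fg2 G0.
have GE : G = (fine G)%:E by rewrite fineK // ge0_fin_numE.
apply/ler_addgt0Pr => r r0.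
(* Solves 12 s + 36 e^2 s = r e^2: this is the total error when both norms of the approximation are
   below s. *)
pose s := r * e ^+ 2 / (12 + 36 * e ^+ 2).
have e20 : 0 < e ^+ 2 by exact: exprn_gt0.
have den0 : 0 < 12 + 36 * e ^+ 2.
  by rewrite addr_gt0 ?ltr0n // mulr_gt0 // ltr0n.
have s0 : 0 < s by rewrite divr_gt0 // mulr_gt0.
have [n [hn1 hn2]] : exists n, (\int[@lebesgue2 R]_(x in wedge om)
     (normsq (phi n x - v x))%:E < s%:E)%E /\
   (\int[@lebesgue2 R]_(x in wedge om)
     (normsq (deriv_field (e2 R) (phi n) x - g2 x))%:E < s%:E)%E.
  have [N _ hN] := filterI (cvg0_lt s0 cv) (cvg0_lt s0 cg2).
  by exists N; have [] := hN N (leqnn N).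
have mphi : field_measurable (T := T2) (wedge om) (phi n).
  by move=> im i; apply: measurable_funTS; exact: field_measurable_smooth.
have mdphi : field_measurable (T := T2) (wedge om) (deriv_field (e2 R) (phi n)).
  by move=> im i; apply: measurable_funTS; exact: field_measurable_deriv.
have mW' : field_measurable (T := T2) (wedge om) W.
  by move=> im i; apply: measurable_funTS; exact: mW.
have est := gap_energy_le e0 c0 mW (sphi n) gap.
(* The gap hypothesis is pointwise and concerns W, whereas the sequence converges to v; under the
   integral the two agree. *)
have IE : (\int[@lebesgue2 R]_(z in wedge om) (normsq (W z - phi n z))%:E =
    \int[@lebesgue2 R]_(z in wedge om) (normsq (phi n z - v z))%:E)%E.
  apply: ge0_ae_eq_integral => //.
  - by apply/measurable_EFinP; exact: (measurable_normsq (field_measurableB mW' mphi)).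
  - by apply/measurable_EFinP; exact: (measurable_normsq (field_measurableB mphi mv)).
  - by move=> z _; rewrite lee_fin; exact: normsq_ge0.
  - by move=> z _; rewrite lee_fin; exact: normsq_ge0.
  - by apply: filterS vW => z vz wz; rewrite vz // -normsqN opprB.
have ID : (\int[@lebesgue2 R]_(z in wedge om) (normsq (deriv_field (e2 R) (phi n) z))%:E
   <= 2%:E * \int[@lebesgue2 R]_(x in wedge om)
     (normsq (deriv_field (e2 R) (phi n) x - g2 x))%:E + 2%:E * G)%E.
  have mdg := measurable_normsq (field_measurableB mdphi mg2).
  have mg := measurable_normsq mg2.
  rewrite -integral_EFinZl //; try by move=> z _; exact: normsq_ge0.
  rewrite -integral_EFinZl //; try by move=> z _; exact: normsq_ge0.
  rewrite -integral_EFinD //; last 4 first.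
  - exact: measurable_funM.
  - exact: measurable_funM.
  - by move=> z _; rewrite mulr_ge0 ?normsq_ge0.
  - by move=> z _; rewrite mulr_ge0 ?normsq_ge0.
  apply: integral_EFin_le => //.
  - exact: measurable_normsq.
  - by apply: measurable_funD; exact: measurable_funM.
  - by move=> z _; exact: normsq_ge0.
  - move=> z _; apply: le_trans (normsqD_le _ _).
    by rewrite subrK.
move: est ID; rewrite IE GE /=.
have P1 : (0 <= \int[@lebesgue2 R]_(x in wedge om) (normsq (phi n x - v x))%:E)%E.
  by apply: integral_EFin_ge0 => z _; exact: normsq_ge0.
have P2 : (0 <= \int[@lebesgue2 R]_(x in wedge om)
     (normsq (deriv_field (e2 R) (phi n) x - g2 x))%:E)%E.
  by apply: integral_EFin_ge0 => z _; exact: normsq_ge0.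
have P3 : (0 <= \int[@lebesgue2 R]_(x in wedge om)
     (normsq (deriv_field (e2 R) (phi n) x))%:E)%E.
  by apply: integral_EFin_ge0 => z _; exact: normsq_ge0.
move: (\int[@lebesgue2 R]_(z in wedge om) (normsq (phi n z - v z))%:E)%E
  hn1 P1 => [I1| |] // hn1 P1.
move: (\int[@lebesgue2 R]_(z in wedge om)
  (normsq (deriv_field (e2 R) (phi n) z - g2 z))%:E)%E hn2 P2 => [I2| |] // hn2 P2.
move: (\int[@lebesgue2 R]_(z in wedge om) (normsq (deriv_field (e2 R) (phi n) z))%:E)%E
  P3 => [I3| |] // P3.
rewrite -!EFinM -!EFinD !lee_fin => est ID.
move: hn1 hn2; rewrite !lte_fin => hn1 hn2.
rewrite !lee_fin in P1 P2 P3.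
rewrite -(ler_pM2r e20).
have sE : 12 * s + 36 * e ^+ 2 * s = r * e ^+ 2.
  by rewrite -mulrDl /s mulrC divfK // lt0r_neq0.
have h1 : e ^+ 2 * I3 <= e ^+ 2 * (2 * I2 + 2 * fine G) by rewrite ler_pM2l.
have h2 : e ^+ 2 * I2 <= e ^+ 2 * s by rewrite ler_pM2l // ltW.
move: (fine G) (e ^+ 2) h1 h2 sE est hn1 => g E2 h1 h2 sE est hn1.
have -> : (36 * g + r) * E2 = 36 * (E2 * g) + r * E2 by ring.
have h1' : 18 * E2 * I3 <= 36 * (E2 * I2) + 36 * (E2 * g).
  have -> : 18 * E2 * I3 = 18 * (E2 * I3) by ring.
  have : E2 * (2 * I2 + 2 * g) = 2 * (E2 * I2) + 2 * (E2 * g) by ring.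
  lra.
have sE' : 12 * s + 36 * (E2 * s) = r * E2 by rewrite -sE; ring.
lra.
Qed.

End H1Bound.

(** * Growth of the singular fields at the vertex *)

Section SingularGap.
Variable R : realType.
Local Notation mu := (@lebesgue_measure R).
Local Notation T2 := (measurableTypeR R * measurableTypeR R)%type.
Implicit Types (nu r x y : R).

(** The integrands compare pointwise; both integrals being finite, the comparison survives the
    passage to real numbers. *)
Lemma besselK_decreasing nu r r' : `|nu| < 1 -> 0 < r -> r <= r' ->
  0 <= besselK nu r' <= besselK nu r.
Proof.
move=> nu1 r0 rr'; have r'0 : 0 < r' := lt_le_trans r0 rr'.
have nu01 : 0 <= `|nu| < 1 by rewrite normr_ge0.
rewrite !(besselK_norm nu); move: `|nu| nu01 => {nu1} n n01.
have F := besselK_integral_fin n01 r0; have F' := besselK_integral_fin n01 r'0.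
apply/andP; split.
  by apply: fine_ge0; apply: integral_EFin_ge0 => t _; exact: besselK_integrand_ge0.
rewrite -lee_fin -[leLHS]/(fine _)%:E -[leRHS]/(fine _)%:E (fineK F) (fineK F').
apply: integral_EFin_le => //.
- by apply: measurable_funTS; exact: measurable_besselK_integrand2.
- by apply: measurable_funTS; exact: measurable_besselK_integrand2.
- by move=> t _; exact: besselK_integrand_ge0.
move=> t _; rewrite ler_wpM2r ?cosh_ge0 // ler_expR !mulNr lerN2.
by rewrite ler_wpM2r ?cosh_ge0.
Qed.

Lemma ler_cos_pi (s t : R) : 0 <= s <= pi -> 0 <= t <= pi ->
  (cos s <= cos t) = (t <= s).
Proof.
move=> s0 t0; rewrite !leNgt ltr_cos // in_itv //=.
Qed.

(** The numbers are rational bounds for cos theta. If y <= e <= x then cos theta >= 1 / sqrt 2 > 2 /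
    3; if x <= 2 e and y >= 3 e then cos theta <= 2 / sqrt 13 < 3 / 5. *)
Definition angle_gap nu : R :=
  cos (`|nu| * acos (2 / 3)) - cos (`|nu| * acos (3 / 5)).

Lemma angle_gap_gt0 nu : nu != 0 -> `|nu| < 1 -> 0 < angle_gap nu.
Proof.
move=> nu0 nu1; have n0 : 0 < `|nu| by rewrite normr_gt0.
have i1 : -1 <= (2 / 3 : R) <= 1 by apply/andP; split; lra.
have i2 : -1 <= (3 / 5 : R) <= 1 by apply/andP; split; lra.
have A : acos (2 / 3) \in `[0, (pi : R)] by rewrite in_itv /= acos_ge0 ?acos_lepi.
have B : acos (3 / 5) \in `[0, (pi : R)] by rewrite in_itv /= acos_ge0 ?acos_lepi.
have AB : acos (2 / 3) < acos (3 / 5) :> R.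
  by rewrite -(ltr_cos A B) !acosK ?in_itv //=; lra.
move: A B; rewrite !in_itv /= => /andP[A0 A1] /andP[B0 B1].
have s (t : R) : 0 <= t -> t <= pi -> 0 <= `|nu| * t <= pi.
  move=> t0 t1; rewrite mulr_ge0 //=.
  by apply: le_trans t1; rewrite ler_piMl // ltW.
by rewrite subr_gt0 ltr_cos ?in_itv /= ?s // ltr_pM2l.
Qed.

Lemma angle_upper x y : 0 <= y -> angle (x, y) = acos (x / radius (x, y)).
Proof. by move=> y0; rewrite /angle /= y0. Qed.

Lemma radius_gt0 x y : 0 < x -> 0 < radius (x, y).
Proof.
by move=> x0; apply: lt_le_trans (radius_ge1 (x, y)); rewrite /= normr_gt0 lt0r_neq0.
Qed.

Lemma radius_reflect x y : radius (x, - y) = radius (x, y).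
Proof. by rewrite /radius /= sqrrN. Qed.

Lemma angle_reflect x y : 0 < x -> 0 <= y -> angle (x, - y) = - angle (x, y).
Proof.
move=> x0; rewrite le_eqVlt => /orP[/eqP <-|y0].
  have -> : angle (x, 0) = 0.
    rewrite angle_upper // /radius /= expr0n addr0 sqrtr_sqr gtr0_norm //.
    by rewrite divff ?lt0r_neq0 // acos1.
  rewrite !oppr0 angle_upper // /radius /= expr0n addr0 sqrtr_sqr gtr0_norm //.
  by rewrite divff ?lt0r_neq0 // acos1.
by rewrite [RHS]/(- angle _) angle_upper ?ltW // /angle radius_reflect /= oppr_ge0 leNgt y0.
Qed.

(** Write K a and K' b for the lower and upper values. As K' <= K and b >= 0, K a - K' b >= K (a -
    b), where a - b is at least [angle_gap nu]. The point (x, y) has radius at most sqrt 5 e <= 3 e,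
    so [besselK_ge] bounds K from below. *)
Lemma bessel_gap nu (L x y : R) : nu != 0 -> `|nu| < 1 -> 1 <= L ->
  let e := expR (- L) in
  e <= x <= 2 * e -> 0 <= y <= e ->
  angle_gap nu * (expR (- 3 - `|nu|) / 2 * expR (`|nu| * L)) <=
  besselK nu (radius (x, y)) * cos (angle (x, y) * nu) -
  besselK nu (radius (x, y + 3 * e)) * cos (angle (x, y + 3 * e) * nu).
Proof.
move=> nu0 nu1 L1 e /andP[ex xe] /andP[y0 ye].
have e0 : 0 < e by exact: expR_gt0.
have x0 : 0 < x := lt_le_trans e0 ex.
set y' := y + 3 * e; have y'e : 3 * e <= y' by rewrite lerDr.
have y'0 : 0 <= y' by lra.
have r0 := radius_gt0 y x0; have r'0 := radius_gt0 y' x0.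
have rs := radius_sqr (x, y); have r's := radius_sqr (x, y').
have sqr_le (a b : R) : 0 <= a -> 0 <= b -> a ^+ 2 <= b ^+ 2 -> a <= b.
  by move=> a0 b0; rewrite ler_pXn2r.
have [r0' r'0'] := (ltW r0, ltW r'0).
have rr' : radius (x, y) <= radius (x, y').
  by apply: sqr_le => //; rewrite rs r's /= lerD2l ler_pXn2r ?nnegrE //; lra.
have rL : 0 < radius (x, y) <= 3 * expR (- L).
  rewrite r0 -/e /=; apply: sqr_le; [lra|lra|rewrite rs /= !expr2; nra].
have q1 : 2 / 3 <= x / radius (x, y).
  have h : 2 * radius (x, y) <= 3 * x.
    by apply: sqr_le; [lra|lra|rewrite !exprMn rs /= !expr2; nra].
  by rewrite ler_pdivlMr //; lra.
have q2 : x / radius (x, y') <= 3 / 5.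
  have h : 5 * x <= 3 * radius (x, y').
    by apply: sqr_le; [lra|lra|rewrite !exprMn r's /= !expr2; nra].
  by rewrite ler_pdivrMr //; lra.
have q3 : 0 <= x / radius (x, y') by rewrite divr_ge0 ?ltW.
have i1 : -1 <= (2 / 3 : R) <= 1 by apply/andP; split; lra.
have i2 : -1 <= (3 / 5 : R) <= 1 by apply/andP; split; lra.
have R1 := ratio_radius_itv (x, y); have R2 := ratio_radius_itv (x, y').
have tA : angle (x, y) <= acos (2 / 3).
  rewrite angle_upper // -ler_cos_pi ?acos_ge0 ?acos_lepi // !acosK ?in_itv //=.
have tB : acos (3 / 5) <= angle (x, y').
  rewrite angle_upper // -ler_cos_pi ?acos_ge0 ?acos_lepi // !acosK ?in_itv //=.
have t0 : 0 <= angle (x, y) by rewrite angle_upper // acos_ge0.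
have t'0 : 0 <= angle (x, y') by rewrite angle_upper // acos_ge0.
have pi0 := pi_ge0 R.
(* With |nu| < 1 this keeps nu theta within a quarter turn, so that the cosine at the upper point is
   nonnegative. *)
have tP : angle (x, y') <= pi / 2.
  rewrite -ler_cos_pi ?t'0 //=.
  - by rewrite cos_pihalf cos_angle.
  - by apply/andP; split; lra.
  - by rewrite angle_upper // acos_lepi.
have n0 : 0 < `|nu| by rewrite normr_gt0.
have cE t : 0 <= t -> cos (t * nu) = cos (`|nu| * t).
  by move=> h; rewrite -cos_norm normrM (ger0_norm h) mulrC.
have s (t : R) : 0 <= t -> t <= pi -> 0 <= `|nu| * t <= pi.
  move=> h0 h1; rewrite mulr_ge0 //=.
  by apply: le_trans h1; rewrite ler_piMl // ltW.
have B1 : acos (3 / 5) <= pi :> R by exact: acos_lepi.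
have B0 : 0 <= acos (3 / 5) :> R by exact: acos_ge0.
have A1 : acos (2 / 3) <= pi :> R by exact: acos_lepi.
have A0 : 0 <= acos (2 / 3) :> R by exact: acos_ge0.
have c1 : cos (`|nu| * acos (2 / 3)) <= cos (angle (x, y) * nu).
  rewrite cE // ler_cos_pi ?s //; first by rewrite ler_pM2l.
  by apply: le_trans A1.
have c2 : cos (angle (x, y') * nu) <= cos (`|nu| * acos (3 / 5)).
  rewrite cE // ler_cos_pi ?s //; first by rewrite ler_pM2l.
  by apply: le_trans tP _; lra.
have c3 : 0 <= cos (angle (x, y') * nu).
  rewrite cE // cos_ge0_pihalf //; apply/andP; split.
    by apply: (@le_trans _ _ 0); [lra|rewrite mulr_ge0].
  by apply: le_trans tP; rewrite ler_piMl // ltW.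
have /andP[K'0 KK'] := besselK_decreasing nu1 r0 rr'.
have KL : expR (- 3 - `|nu|) / 2 * expR (`|nu| * L) <= besselK nu (radius (x, y)).
  by rewrite [leRHS]besselK_norm; apply: besselK_ge => //; rewrite normr_ge0.
have K0 : 0 <= expR (- 3 - `|nu|) / 2 * expR (`|nu| * L).
  by rewrite mulr_ge0 ?divr_ge0 ?expR_ge0.
have G := angle_gap_gt0 nu0 nu1.
apply: (@le_trans _ _ (angle_gap nu * besselK nu (radius (x, y)))).
  by rewrite ler_pM2l.
rewrite /angle_gap.
move: c1 c2 c3 K'0 KK'.
move: (cos (angle (x, y) * nu)) (cos (angle (x, y') * nu)) => a b.
move: (besselK nu (radius (x, y))) (besselK nu (radius (x, y'))) => K K'.
move: (cos (`|nu| * acos (2 / 3))) (cos (`|nu| * acos (3 / 5))) => u v c1 c2 c3 K'0 KK'.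
have K00 := le_trans K'0 KK'.
have : 0 <= K * (a - u) by apply: mulr_ge0; rewrite ?subr_ge0.
have : 0 <= K * (v - b) by apply: mulr_ge0; rewrite ?subr_ge0.
have : K' * b <= K * b by rewrite ler_wpM2r.
lra.
Qed.

End SingularGap.

(** * Separation of the two singular fields and their absence from H^1 *)

Section SingularNotH1.
Variable R : realType.
Local Notation T2 := (measurableTypeR R * measurableTypeR R)%type.
Variable om : R.
Hypotheses (om1 : pi / 2 < om) (om2 : om < pi).
Implicit Types (al be c : R[i]).

Let om0 : 0 < om.
Proof. by apply: lt_trans om1; rewrite divr_gt0 ?pi_gt0. Qed.

Lemma cnormsq_ge0 c : 0 <= cnormsq c.
Proof. by rewrite addr_ge0 ?sqr_ge0. Qed.

Lemma cnormsqM c c' : cnormsq (c * c') = cnormsq c * cnormsq c'.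
Proof. by case: c c' => [a b] [a' b']; rewrite /cnormsq /=; ring. Qed.

Lemma cnormsq_eq0 c : (cnormsq c == 0) = (c == 0).
Proof.
case: c => a b; rewrite /cnormsq /= paddr_eq0 ?sqr_ge0 // !sqrf_eq0.
by rewrite eq_complex.
Qed.

Lemma cnormsqD_le c c' : cnormsq (c + c') <= 2 * cnormsq c + 2 * cnormsq c'.
Proof.
case: c c' => [a b] [a' b']; rewrite /cnormsq /=.
have := sqr_ge0 (a - a'); have := sqr_ge0 (b - b'); nra.
Qed.

Lemma normsq_cnormsq (z : spinor R) : normsq z = cnormsq (z 0 0) + cnormsq (z 1 0).
Proof. exact: normsqE. Qed.

Lemma sing0E z : sing0 om z 0 0 = (besselK (nu0 om) (radius z))%:C%C *
    ((1 / (2 * Num.sqrt om))%:C%C * cis (angle z * nu0 om)) /\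
  sing0 om z 1 0 = (besselK (nu0 om) (radius z))%:C%C *
    ((1 / (2 * Num.sqrt om))%:C%C * (- imag R * cis (- (angle z * nu0 om)))).
Proof.
by rewrite (scale_entry _ (u0 _ _)) (scale_entry _ (u0 _ _)) (scale_entry _ (spinor2 _ _))
  (scale_entry _ (spinor2 _ _)) spinor2_0 spinor2_1.
Qed.

Lemma sing1E z : sing1 om z 0 0 = (besselK (nu0 om + 1) (radius z))%:C%C *
    ((1 / (2 * Num.sqrt om))%:C%C * cis (- (angle z * (nu0 om + 1)))) /\
  sing1 om z 1 0 = (besselK (nu0 om + 1) (radius z))%:C%C *
    ((1 / (2 * Num.sqrt om))%:C%C * (imag R * cis (angle z * (nu0 om + 1)))).
Proof.
by rewrite (scale_entry _ (um1 _ _)) (scale_entry _ (um1 _ _)) (scale_entry _ (spinor2 _ _))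
  (scale_entry _ (spinor2 _ _)) spinor2_0 spinor2_1.
Qed.

Lemma sing_reflectE x y : 0 < x -> 0 <= y ->
  sing0 om (x, - y) 1 0 = (besselK (nu0 om) (radius (x, y)))%:C%C *
    ((1 / (2 * Num.sqrt om))%:C%C * (- imag R * cis (angle (x, y) * nu0 om))) /\
  sing1 om (x, - y) 1 0 = (besselK (nu0 om + 1) (radius (x, y)))%:C%C *
    ((1 / (2 * Num.sqrt om))%:C%C * (imag R * cis (- (angle (x, y) * (nu0 om + 1))))).
Proof.
move=> x0 y0; have [_ s0] := sing0E (x, - y); have [_ s1] := sing1E (x, - y).
split; [apply: etrans s0 _|apply: etrans s1 _].
  by rewrite radius_reflect angle_reflect // [- angle _ * _]mulNr opprK.
by rewrite radius_reflect angle_reflect // [- angle _ * _]mulNr.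
Qed.

(** The two fields carry opposite factors - i and i in w2, so adding or subtracting i w2 cancels one
    of them and doubles the other. *)
Lemma decoupling_algebra (k s t a b al be w1 w2 : R[i]) :
  w1 = al * (s * (k * a)) + be * (t * (k * b)) ->
  w2 = al * (s * (k * (- imag R * a))) + be * (t * (k * (imag R * b))) ->
  w1 + imag R * w2 = (k + k) * al * (s * a) /\
  w1 - imag R * w2 = (k + k) * be * (t * b).
Proof.
move=> -> ->; move: imag_sqr => i2.
have -> : imag R * (al * (s * (k * (- imag R * a))) + be * (t * (k * (imag R * b))))
  = - (imag R * imag R) * (al * (s * (k * a))) + imag R * imag R * (be * (t * (k * b))).
  by ring.
by rewrite i2; split; ring.
Qed.

(* The reflection y |-> - y exchanges the two spinor components of each singular
   field up to a sign, which separates the two fields. *)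
Lemma singular_decoupling al be x y : 0 < x -> 0 <= y ->
  let W := fun z => al *: sing0 om z + be *: sing1 om z in
  let k := (1 / (2 * Num.sqrt om)) in
  W (x, y) 0 0 + imag R * W (x, - y) 1 0 =
    (2 * k)%:C%C * al * ((besselK (nu0 om) (radius (x, y)))%:C%C *
       cis (angle (x, y) * nu0 om)) /\
  W (x, y) 0 0 - imag R * W (x, - y) 1 0 =
    (2 * k)%:C%C * be * ((besselK (nu0 om + 1) (radius (x, y)))%:C%C *
       cis (- (angle (x, y) * (nu0 om + 1)))).
Proof.
move=> x0 y0 W k.
have [s00 _] := sing0E (x, y); have [s10 _] := sing1E (x, y).
have [s01 s11] := sing_reflectE x0 y0.
have kE : (2 * k)%:C%C = k%:C%C + k%:C%C :> R[i].
  by rewrite -rmorphD /=; congr (_ %:C)%C; ring.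
rewrite kE; apply: decoupling_algebra.
  apply: etrans (spinor_addE _ _ _) (congr2 +%R _ _).
    by apply: etrans (scale_entry _ _ _) (congr1 ( *%R al) s00).
  by apply: etrans (scale_entry _ _ _) (congr1 ( *%R be) s10).
apply: etrans (spinor_addE _ _ _) (congr2 +%R _ _).
  by apply: etrans (scale_entry _ _ _) (congr1 ( *%R al) s01).
by apply: etrans (scale_entry _ _ _) (congr1 ( *%R be) s11).
Qed.

Lemma Re_sqr_le c : complex.Re c ^+ 2 <= cnormsq c.
Proof. by rewrite lerDl sqr_ge0. Qed.

(** Here s stands for i or - i. The square of the combined increment is at least (2 k)^2 |c|^2 g^2,
    by its real part alone, and at most twice the sum of the squared increments, which leaves 2
    k^2. *)
Lemma gap_ge_of_decoupling (p p' q q' : spinor R) (k g : R) (c s z z' : R[i]) :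
  cnormsq s = 1 ->
  p 0 0 + s * q 1 0 = (2 * k)%:C%C * c * z ->
  p' 0 0 + s * q' 1 0 = (2 * k)%:C%C * c * z' ->
  0 <= g -> g <= complex.Re (z - z') ->
  2 * k ^+ 2 * cnormsq c * g ^+ 2 <= normsq (p - p') + normsq (q - q').
Proof.
move=> s1 e1 e2 g0 gz.
have ZE : (p - p') 0 0 + s * (q - q') 1 0 = (2 * k)%:C%C * c * (z - z').
  by rewrite [RHS]mulrBr -e1 -e2 !spinor_addE !spinor_oppE; ring.
have le1 : cnormsq ((p - p') 0 0 + s * (q - q') 1 0) <=
    2 * cnormsq ((p - p') 0 0) + 2 * cnormsq ((q - q') 1 0).
  by apply: le_trans (cnormsqD_le _ _) _; rewrite (cnormsqM s) s1 mul1r.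
have le2 : 4 * k ^+ 2 * cnormsq c * g ^+ 2 <=
    cnormsq ((p - p') 0 0 + s * (q - q') 1 0).
  rewrite ZE !cnormsqM.
  have -> : cnormsq (2 * k)%:C%C = 4 * k ^+ 2 by rewrite /cnormsq /=; ring.
  apply: ler_wpM2l; first exact (mulr_ge0 (mulr_ge0 (ler0n _ 4) (sqr_ge0 k)) (cnormsq_ge0 c)).
  apply: le_trans (Re_sqr_le _).
  by rewrite ler_pXn2r // nnegrE (le_trans g0).
rewrite !normsq_cnormsq.
have := cnormsq_ge0 ((p - p') 1 0); have := cnormsq_ge0 ((q - q') 0 0).
have -> : 2 * k ^+ 2 * cnormsq c * g ^+ 2 = 4 * k ^+ 2 * cnormsq c * g ^+ 2 / 2.
  by field.
lra.
Qed.

Lemma singular_gap_ge (b : bool) al be (L x y : R) :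
  let W := fun z => al *: sing0 om z + be *: sing1 om z in
  let nu := if b then nu0 om else nu0 om + 1 in
  let k := (1 / (2 * Num.sqrt om)) in
  let e := expR (- L) in
  1 <= L -> e <= x <= 2 * e -> 0 <= y <= e ->
  2 * k ^+ 2 * cnormsq (if b then al else be) *
    (angle_gap nu * (expR (- 3 - `|nu|) / 2 * expR (`|nu| * L))) ^+ 2
    <= vertical_gap W e x y.
Proof.
move=> W nu k e L1 xe ye.
have e0 : 0 < e by exact: expR_gt0.
have [x0 y0 y'0] : [/\ 0 < x, 0 <= y & 0 <= y + 3 * e].
  by move/andP: xe ye => [? ?] /andP[? ?]; split; lra.
have [d1 d2] := singular_decoupling al be x0 y0.
have [d1' d2'] := singular_decoupling al be x0 y'0.
have [hn0 hn1] : nu != 0 /\ `|nu| < 1.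
  have := nu0_lt0 om1; have := nu0_gt om1; rewrite /nu.
  case: b {nu} => h1 h2; split; rewrite ?ltr_norml; try (apply/andP; split); try lra;
    apply/eqP; lra.
have gD := bessel_gap hn0 hn1 L1 xe ye.
have g0 : 0 <= angle_gap nu * (expR (- 3 - `|nu|) / 2 * expR (`|nu| * L)).
  apply: mulr_ge0; first exact: ltW (angle_gap_gt0 hn0 hn1).
  by rewrite mulr_ge0 ?divr_ge0 ?expR_ge0.
have ci : cnormsq (imag R) = 1 by rewrite /cnormsq /=; ring.
have cNi : cnormsq (- imag R) = 1 by rewrite /cnormsq /=; ring.
have Re_cis (K t : R) : complex.Re (K%:C%C * cis t) = K * cos t.
  by rewrite /= mul0r subr0.
have ReB (z z' : R[i]) : complex.Re (z - z') = complex.Re z - complex.Re z'.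
  by case: z z' => [? ?] [? ?].
rewrite /vertical_gap; move: g0 gD; rewrite /nu => {hn0 hn1 nu}.
case: (b) => /= g0 gD.
  by apply: (gap_ge_of_decoupling ci d1 d1' g0); rewrite ReB !Re_cis.
(* The difference is rewritten as a sum with s = - i. The negative phase does not matter later,
   because cos is even. *)
have {}d2 := etrans (congr1 (fun w => _ + w) (mulNr _ _)) d2.
have {}d2' := etrans (congr1 (fun w => _ + w) (mulNr _ _)) d2'.
by apply: (gap_ge_of_decoupling cNi d2 d2' g0); rewrite ReB !Re_cis !cosN.
Qed.

Lemma field_measurable_singular al be :
  field_measurable (T := T2) setT (fun z => al *: sing0 om z + be *: sing1 om z).
Proof.
apply: field_measurableD; apply: field_measurableZ; try exact: cmeasurable_cst.
  exact: measurable_sing0.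
exact: measurable_sing1.
Qed.

(* The gap grows like e^(2 |nu| L) at distance e^-L from the vertex. *)
Lemma singular_not_H1 (v : spinor_field R) t al be : is_trace om v t ->
  ae_eq (@lebesgue2 R) (wedge om) v (fun z => al *: sing0 om z + be *: sing1 om z) ->
  al = 0 /\ be = 0.
Proof.
move=> trv vW.
have [M HM] := vertical_gap_bound om1 om2 trv (field_measurable_singular al be) vW.
have main (b : bool) : (if b then al else be) = 0.
  apply/eqP; rewrite -cnormsq_eq0; apply/negPn/negP => ab0.
  have {}ab0 : 0 < cnormsq (if b then al else be) by rewrite lt0r ab0 cnormsq_ge0.
  pose nu := if b then nu0 om else nu0 om + 1.
  have [hn0 hn1] : nu != 0 /\ `|nu| < 1.
    have := nu0_lt0 om1; have := nu0_gt om1; rewrite /nu.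
    case: b {nu ab0} => h1 h2; split; rewrite ?ltr_norml; try (apply/andP; split);
      try lra; apply/eqP; lra.
  have n0 : 0 < `|nu| by rewrite normr_gt0.
  have G := angle_gap_gt0 hn0 hn1.
  pose k : R := 1 / (2 * Num.sqrt om).
  have k0 : 0 < k by rewrite divr_gt0 // mulr_gt0 // sqrtr_gt0.
  pose d := angle_gap nu * (expR (- 3 - `|nu|) / 2).
  have d0 : 0 < d by rewrite mulr_gt0 // divr_gt0 ?expR_gt0.
  pose C := 2 * k ^+ 2 * cnormsq (if b then al else be) * d ^+ 2.
  have C0 : 0 < C.
    exact (mulr_gt0 (mulr_gt0 (mulr_gt0 (ltr0Sn _ 1) (exprn_gt0 2 k0)) ab0) (exprn_gt0 2 d0)).
  (* Chosen so that C (1 + |nu| L) = C + C |nu| + |M| exceeds M, while e^(2 |nu| L) >= 1 + |nu|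
     L. *)
  pose L := 1 + `|M| / (C * `|nu|).
  have q0 : 0 <= `|M| / (C * `|nu|) by rewrite divr_ge0 // ltW // mulr_gt0.
  have L1 : 1 <= L by rewrite lerDl.
  have : C * expR (`|nu| * L) ^+ 2 <= M.
    apply: (HM (expR (- L))); first exact: expR_gt0.
      by rewrite mulr_ge0 ?sqr_ge0 // ltW.
    move=> x y xe ye; apply: le_trans (singular_gap_ge b al be L1 xe ye).
    by rewrite le_eqVlt; apply/orP; left; apply/eqP; rewrite -/nu -/k /C /d; ring.
  have e1 : 1 + `|nu| * L <= expR (`|nu| * L) by exact: expR_ge1Dx.
  have nL : 0 <= `|nu| * L by rewrite mulr_ge0 // (le_trans _ L1).
  have e2 : 1 + `|nu| * L <= expR (`|nu| * L) ^+ 2.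
    rewrite expr2; move: (expR _) e1 => E e1; nra.
  have e3 : C * (1 + `|nu| * L) <= C * expR (`|nu| * L) ^+ 2 by rewrite ler_pM2l.
  have e4 : C * (1 + `|nu| * L) = C + C * `|nu| + `|M|.
    rewrite /L; field; rewrite ?lt0r_neq0 //.
  have e5 : M <= `|M| by exact: ler_norm.
  have e6 : 0 < C * `|nu| by rewrite mulr_gt0.
  lra.
by split; [exact: (main true)|exact: (main false)].
Qed.

End SingularNotH1.

(** * The extensions *)

Section ZeroField.
Variable R : realType.

Let zero_field : spinor_field R := fun=> 0.

Lemma rcoord_zero (T : Type) im i : rcoord im i (fun _ : T => 0 : spinor R) = fun=> 0.
Proof. by apply/funext => x; rewrite /rcoord mxE; case: im. Qed.

Lemma normsq0 : normsq (0 : spinor R) = 0.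
Proof. by rewrite normsqE !mxE /= expr0n /= !addr0. Qed.

Lemma L2_zero d (T : measurableType d) (mu : {measure set T -> \bar R}) A :
  L2 mu A (fun=> 0).
Proof.
split; first by move=> im i; rewrite rcoord_zero; exact: measurable_cst.
by under eq_integral do rewrite normsq0; rewrite integral0 ltry.
Qed.

Lemma L2_cvg_zero d (T : measurableType d) (mu : {measure set T -> \bar R}) A :
  L2_cvg mu A (fun _ _ => 0) (fun=> 0).
Proof.
rewrite /L2_cvg; under eq_fun do (under eq_integral do rewrite subrr normsq0).
by under eq_fun do rewrite integral0; exact: cvg_cst.
Qed.

Lemma smooth_iter_zero (s : seq (R * R)) :
  foldr (fun v h => 'D_v h) (fun _ : R * R => 0 : R) s = fun=> 0.
Proof.
by elim: s => [//|v s /= ->]; apply/funext => x; rewrite derive_cst.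
Qed.

Lemma test_fun_zero : test_fun setT (fun _ : R * R => 0 : R).
Proof.
split => //.
- by move=> s x; rewrite smooth_iter_zero; exact: differentiable_cst.
- rewrite /fun_supp (_ : [set x | _] = set0) ?closure0; first exact: compact0.
  by apply/seteqP; split => x //=; rewrite eqxx.
Qed.

Lemma smooth_field_zero : smooth_field zero_field.
Proof. by move=> im i; rewrite rcoord_zero; exact: test_fun_zero. Qed.

Lemma deriv_field_zero v : deriv_field v zero_field = zero_field.
Proof.
apply: rcoord_inj => im i; rewrite rcoord_deriv_field !rcoord_zero.
by apply/funext => x; rewrite derive_cst.
Qed.

Lemma H1_grad_zero Om : H1_grad Om zero_field zero_field zero_field.
Proof.
have wd v : weak_deriv Om v zero_field zero_field.
  move=> f im i _; rewrite rcoord_zero.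
  under eq_Rintegral do rewrite mul0r.
  under [in RHS]eq_Rintegral do rewrite mul0r.
  by rewrite /Rintegral integral0 oppr0.
by split => //; exact: L2_zero.
Qed.

(** Taking the regular part to be zero puts v_+ + gamma v_- itself in the domain of D^gamma. *)
Lemma dirac_op_zero (om m : R) : dirac_op om m (zero_field, zero_field).
Proof.
split; first exact: L2_zero.
exists zero_field, zero_field; split; first exact: H1_grad_zero.
- exists (fun _ _ => 0).
    exists (fun=> zero_field), zero_field, zero_field; split.
    + by move=> n; exact: smooth_field_zero.
    + exact: H1_grad_zero.
    + split; first exact: L2_cvg_zero.
      * rewrite (_ : (fun n => _) = fun _ _ => 0); first exact: L2_cvg_zero.
        by apply/funext => n; exact: deriv_field_zero.
      * rewrite (_ : (fun n => _) = fun _ _ => 0); first exact: L2_cvg_zero.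
        by apply/funext => n; exact: deriv_field_zero.
    + by move=> s; split; [exact: L2_zero|exact: L2_cvg_zero].
  by move=> s; apply: nearW => x _; rewrite mulmx0.
- by apply: nearW => x _; rewrite /zero_field !mulmx0 addr0 !scaler0 addr0.
Qed.

End ZeroField.

(** * Comparison of the domains of the extensions *)

Section Extensions.
Variables (R : realType) (m om : R).
Hypotheses (om1 : pi / 2 < om) (om2 : om < pi).
Implicit Types gamma : R[i].

(** The square integrability of v_+ and v_- is spent here: the graph requires it of the field and of
    its image. *)
Lemma deficiency_mem_ext gamma :
  op_domain (dirac_ext om m gamma) (fun x => vplus om x + gamma *: vminus om x).
Proof.
have om0 : 0 < om by apply: lt_trans om1; rewrite divr_gt0 ?pi_gt0.
have mW := measurable_wedge om0 om2.
have Lp := L2_vplus om1 om2; have Lm := L2_vminus om1 om2.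
have Lg c : L2 (@lebesgue2 R) (wedge om) (fun x => c *: vminus om x) by exact: L2Z.
have Ls := L2D mW Lp (Lg gamma); have Ld := L2B mW Lp (Lg gamma).
exists (fun x => vplus om x + gamma *: vminus om x,
  fun x => imag R *: (vplus om x - gamma *: vminus om x)
    + (m%:C)%C *: (sigma3 R *m (vplus om x + gamma *: vminus om x))); last reflexivity.
split; first exact: Ls.
  have L3 := L2_sigma3 Ls.
  have L4 := L2D mW (L2Z mW (imag R) Ld) (L2Z mW (m%:C)%C L3).
  exact: L4.
exists (fun=> 0), (fun=> 0), 1; split; first exact: dirac_op_zero.
- by apply: nearW => x _; rewrite add0r scale1r.
- by apply: nearW => x _; rewrite add0r scale1r.
Qed.

Lemma deficiency_singular (a b : R[i]) x :
  a *: vplus om x + b *: vminus om x =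
  (a + b) *: sing0 om x + (imag R * (b - a)) *: sing1 om x.
Proof.
rewrite vplusE vminusE; move: (sing0 om x) (sing1 om x) => p q.
rewrite scalerBr scalerDr addrACA -scalerDl; congr (_ + _).
by rewrite !scalerA addrC -scalerBl -mulrBl mulrC.
Qed.

(** The field v_+ + conj(gamma) v_- then equals v + c (v_+ + gamma v_-) with v in the domain of D,
    so v = a v_+ + b v_- with a = 1 - c and b = conj(gamma) - c gamma. Both vanish, which gives c =
    1 and then the claim. *)
Lemma C_invariant_real gamma : C_invariant (dirac_ext om m gamma) ->
  conjc gamma = gamma.
Proof.
rewrite /C_invariant charge_conj_domain_ext => E.
have := deficiency_mem_ext (conjc gamma); rewrite E.
move=> [[u f] /= [_ _ [v [h [c [[/= _ [g1 [g2 [_ [t trv _] _]]]] uE _]]]]] uw].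
move: uE; rewrite /= uw => uE.
have vE : ae_eq (@lebesgue2 R) (wedge om) v (fun x =>
    ((1 - c) + (conjc gamma - c * gamma)) *: sing0 om x
    + (imag R * ((conjc gamma - c * gamma) - (1 - c))) *: sing1 om x).
  apply: filterS uE => x ux wx; rewrite -deficiency_singular.
  have := ux wx; move: (vplus om x) (vminus om x) (v x) => p q z pq.
  have -> : z = p + conjc gamma *: q - c *: (p + gamma *: q) by rewrite pq addrK.
  by rewrite !scalerBl scale1r scalerDr scalerA opprD addrACA.
have [e1 e2] := singular_not_H1 om1 om2 trv vE.
have i0 : imag R != 0 by rewrite /imag eq_complex /= oner_eq0 andbF.
(* In terms of a and b the two coefficients are a + b and i (b - a): the second gives b = a, the
   first then 2 a = 0. *)
move/eqP: e2; rewrite mulf_eq0 (negbTE i0) /= subr_eq0 => /eqP e2.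
move: e1; rewrite e2 -mulr2n => /eqP; rewrite mulrn_eq0 /= subr_eq0 => /eqP c1.
by move: e2; rewrite -c1 mul1r subrr => /eqP; rewrite subr_eq0 => /eqP.
Qed.

Lemma unit_real_complex gamma : `|gamma| = 1 -> conjc gamma = gamma ->
  gamma = 1 \/ gamma = -1.
Proof.
case: gamma => a b; rewrite normc_def /= => -[n1] [bb].
have b0 : b = 0 by lra.
move: n1; rewrite b0 expr0n addr0 sqrtr_sqr => /eqP; rewrite eqr_norml ler01 andbT.
case/orP => /eqP ->; [left|right] => //.
by rewrite oppCE oppr0.
Qed.

Lemma C_invariantP gamma : `|gamma| = 1 ->
  C_invariant (dirac_ext om m gamma) <-> gamma = 1 \/ gamma = -1.
Proof.
move=> g1; split => [/C_invariant_real|g]; first exact: unit_real_complex.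
apply: dirac_ext_C_invariant.
by case: g => ->; rewrite ?rmorphN rmorph1.
Qed.

End Extensions.

Theorem proposition1p6 (R : realType) (m om : R)
  (hom1 : pi / 2 < om) (hom2 : om < pi) :
  [/\ forall gamma : R[i], `|gamma| = 1 ->
        (C_invariant (dirac_ext om m gamma) <-> gamma = 1 \/ gamma = -1),
      forall gamma : R[i], gamma = 1 \/ gamma = -1 ->
        C_anticommutes om (dirac_ext om m gamma) &
      (forall S : operator R, selfadjoint_extension om (dirac_op om m) S <->
         exists2 gamma : R[i], `|gamma| = 1 & S = dirac_ext om m gamma) ->
      forall S : operator R, selfadjoint_extension om (dirac_op om m) S ->
        (C_invariant S <-> S = dirac_ext om m 1 \/ S = dirac_ext om m (-1))].
Proof.
have CP (gamma : R[i]) := @C_invariantP R m om hom1 hom2 gamma.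
split.
- exact: CP.
- move=> gamma g; apply: dirac_ext_anticommutes.
  by case: g => ->; rewrite ?rmorphN rmorph1.
(* The classification H names S as some D^gamma, to which the first clause applies. *)
- move=> H S /H[gamma g1 ->]; split; first by move=> /(CP _ g1)[->|->]; [left|right].
  by case=> ->; apply/CP; rewrite ?normrN ?normr1 //; [left|right].
Qed.
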